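(* Let $f:(0,\infty)^2\to(0,\infty)$ be a symmetric real function that is increasing in the variable $x$. Let $s,t$ be positive integers such that $2s+t-1=n\geq 8$ and $|s-t|\leq 1$. Then $\Theta(s,s,t)$ and $\infty(s,s,t)$ are the extremal graphs with the smallest $\rho_f$ in $\mathcal{B}_n$; that is, both attain the minimum of $\rho_f$ over $\mathcal{B}_n$, and every graph in $\mathcal{B}_n$ attaining this minimum is isomorphic to one of them.
   Context: All graphs are finite, simple and undirected; $d_G(v)$ is the degree of $v$ in $G$. For a connected graph $G$ with vertices $v_1,\dots,v_n$ of degrees $d_1,\dots,d_n$, the $f$-adjacency matrix $A_f(G)$ has $(i,j)$-entry $f(d_i,d_j)$ if $v_iv_j\in E(G)$ and $0$ otherwise; $\rho_f(G)$ is the spectral radius of $A_f(G)$. ''Increasing in the variable $x$'' means non-decreasing in $x$ for each fixed $y$. $\mathcal{B}_n$ is the set of all bicyclic graphs of order $n$, i.e. connected graphs with $n$ vertices and $n+1$ edges (pendant vertices allowed). $\Theta(l_1,l_2,l_3)$ is the graph consisting of two distinct vertices $u,v$ joined by three internally disjoint paths of lengths $l_1,l_2,l_3\geq 1$ (at most one of the lengths equals $1$). $\infty(l_1,l_2,l_3)$ (with $l_1,l_2\geq3$, $l_3\geq1$) is the graph obtained from two vertex-disjoint cycles $C_{l_1}$ and $C_{l_2}$ by joining a vertex $u$ of $C_{l_1}$ and a vertex $v$ of $C_{l_2}$ by a path of length $l_3$. *)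

(* Defs.v *)
From mathcomp Require Import all_boot all_order all_algebra.
From mathcomp Require Import classical_sets reals complex.
Set Implicit Arguments.
Unset Strict Implicit.
Unset Printing Implicit Defensive.
Import Order.TTheory GRing.Theory Num.Theory.
Local Open Scope ring_scope.

Record sgraph := SGraph {
  vertex :> finType;
  adj : rel vertex;
  adj_sym : symmetric adj;
  adj_irrefl : irreflexive adj }.

Definition neighbors (G : sgraph) (v : G) : {set G} := [set w | adj v w]%SET.

Definition degree (G : sgraph) (v : G) : nat := #|neighbors v|.

Definition edges (G : sgraph) : {set {set G}} :=
  [set e : {set G} |
     [exists x : G, [exists y : G, adj x y && (e == [set x; y]%SET)]]]%SET.

Definition connected_graph (G : sgraph) : Prop :=
  forall x y : G, connect (@adj G) x y.

Definition graph_iso (G H : sgraph) : Prop :=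
  exists2 h : G -> H, bijective h & forall x y : G, adj (h x) (h y) = adj x y.

Definition bicyclic (n : nat) (G : sgraph) : Prop :=
  [/\ #|G| = n, connected_graph G & #|edges G| = n.+1].

Section WalkGraph.
Variables (n : nat) (ws : seq (seq nat)).

(* The simple graph on {0, .., n-1} whose edges are the pairs of distinct
   vertices that occur consecutively, in either order, in one of the walks. *)
Definition walk_adj : rel 'I_n := fun i j =>
  (i != j) &&
  has (fun w => infix [:: val i; val j] w || infix [:: val j; val i] w) ws.

Lemma walk_adj_sym : symmetric walk_adj.
Proof.
by move=> i j; rewrite /walk_adj eq_sym; congr andb; apply: eq_has => w; rewrite orbC.
Qed.

Lemma walk_adj_irrefl : irreflexive walk_adj.
Proof. by move=> i; rewrite /walk_adj eqxx. Qed.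

Definition walk_graph : sgraph := SGraph walk_adj_sym walk_adj_irrefl.

End WalkGraph.

(* In both graphs below u is 0 and v is 1; the internal vertices of the three
   paths (for infinity_graph: the vertices of the first cycle other than u,
   those of the second cycle other than v, and the internal vertices of the
   connecting path) are l1 - 1, l2 - 1 and l3 - 1 consecutive numbers from 2
   onwards. theta_graph is meant for lengths at least 1, at most one of them
   equal to 1; infinity_graph for l1, l2 >= 3 and l3 >= 1. *)
Definition theta_graph (l1 l2 l3 : nat) : sgraph :=
  walk_graph (l1 + l2 + l3 - 1)
    [:: 0%N :: iota 2 (l1 - 1) ++ [:: 1%N];
        0%N :: iota (l1 + 1) (l2 - 1) ++ [:: 1%N];
        0%N :: iota (l1 + l2) (l3 - 1) ++ [:: 1%N]].

Definition infinity_graph (l1 l2 l3 : nat) : sgraph :=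
  walk_graph (l1 + l2 + l3 - 1)
    [:: 0%N :: iota 2 (l1 - 1) ++ [:: 0%N];
        1%N :: iota (l1 + 1) (l2 - 1) ++ [:: 1%N];
        0%N :: iota (l1 + l2) (l3 - 1) ++ [:: 1%N]].

Section SpectralRadius.
Variable R : realType.

Definition f_adjacency (f : R -> R -> R) (G : sgraph) : 'M[R]_#|G| :=
  \matrix_(i, j)
    if adj (enum_val i) (enum_val j)
    then f (degree (enum_val i))%:R (degree (enum_val j))%:R
    else 0.

(* Largest modulus of a complex eigenvalue; on R[i] the norm `|z| is itself an
   element of R[i], hence the real part. *)
Definition spectral_radius (m : nat) (A : 'M[R]_m) : R :=
  sup [set complex.Re `|z| | z in
        [set z : R[i] | eigenvalue (map_mx (real_complex R) A) z]]%classic.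

Definition rho (f : R -> R -> R) (G : sgraph) : R :=
  spectral_radius (f_adjacency f G).

Definition minimizes_rho (f : R -> R -> R) (n : nat) (G : sgraph) : Prop :=
  bicyclic n G /\ forall H : sgraph, bicyclic n H -> rho f G <= rho f H.

End SpectralRadius.

(* Main.v *)
Require Import Defs.
From mathcomp Require Import all_boot all_order all_algebra.
From mathcomp Require Import reals complex.
From mathcomp Require Import zify ring lra.
Set Implicit Arguments.
Unset Strict Implicit.
Unset Printing Implicit Defensive.

(* A connected graph with n vertices and more than n edges contains a theta, an
   infinity or an eight (two cycles with a common vertex) as a subgraph.  On its
   arms put the solution of a (x_(i-1) + x_(i+1)) = lam x_i with value 1 at the
   branch vertices, where a = f(2,2), b = f(2,3) and lam = a (q + 1 / q), and put
   0 elsewhere.  As f is monotone, the Rayleigh quotient of this vector is at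
   least lam as soon as the sum over the arms of (b^2 / a) g(length) is, for an
   explicit strictly convex decreasing g; only at the branch vertices is there
   anything to check, and for an infinity it is enough to check the sum over the
   two of them, since both carry the value 1.
   The number q is chosen with lam = (b^2 / a) (2 g(s) + g(t)), so that the
   vector is a positive eigenvector on Theta(s,s,t) and on infinity(s,s,t), both
   of which thus have spectral radius lam.  Convexity of g makes the balanced
   lengths optimal, with equality only for them; equality in the Rayleigh bound
   forces an eigenvector, which for an infinity makes the two cycles equally
   long.  The eight and the arms of length 1 are excluded by strict inequalities,
   which is where n >= 8 is used. *)

(** * Theta, infinity and eight subgraphs *)

(** The test vector lives in the large graph. On the structure the actual degrees are at least 3 at
    branch vertices and at least 2 inside the arms, so monotonicity of [f] is used in one direction
    only. Vertices off the structure merely leave less length for the arms, which raises the bound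
    because g decreases; hence only an upper bound on the total length enters, and equality makes
    the structure spanning.

    The obstacle is an arm that is a single edge. Its weight [f 3 3] is only known to be at least b,
    while the convex sequence would require (b^2 / a) g(1) = b^2 / a >= b, so convexity does not
    cover it. Eliminating a and b by the equation for q leaves an inequality in q and the lengths,
    and finitely many small lengths need an estimate of their own. For an eight the constants are
    nearly tight as well: s, t >= 3 give lam <= (b^2 / a) 3 g(3) <= (b^2 / a) 4 q, and q is the
    limit of g, so each of the four ends of its two cycles contributes more than (b^2 / a) q. *)

Lemma split_first (T : Type) (a : pred T) (s : seq T) : has a s ->
  exists p1 w p2, [/\ s = p1 ++ w :: p2, a w & ~~ has a p1].
Proof.
elim: s => //= x s IH; case: (boolP (a x)) => [ax _|ax /=].
  by exists [::], x, s.
by move=> /IH[p1 [w [p2 [-> aw np]]]]; exists (x :: p1), w, p2; rewrite /= negb_or ax.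
Qed.

Lemma index_cat_cons (T : eqType) (w : T) (r t : seq T) :
  uniq (r ++ w :: t) -> index w (r ++ w :: t) = size r.
Proof.
rewrite uniq_catC /= mem_cat negb_or => /andP[/andP[_ wr] _].
by rewrite index_cat (negPf wr) /= eqxx addn0.
Qed.

Lemma cat_cons_inj (T : eqType) (w : T) (a b c d : seq T) :
  uniq (a ++ w :: c) -> a ++ w :: c = b ++ w :: d -> a = b.
Proof.
move=> ua e; have ub := ua; rewrite e in ub.
have /(congr1 (index w)) := e; rewrite !index_cat_cons// => sz.
by move/eqP: e; rewrite eqseq_cat// => /andP[/eqP].
Qed.

(* An adjacent pair is determined by its edge and by the order of its two
   components in the enumeration of the vertices. *)
Lemma degree_sum_le (G : sgraph) : (\sum_(v : G) degree v <= 2 * #|edges G|)%N.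
Proof.
pose D := [set p : G * G | adj p.1 p.2].
have -> : (\sum_(v : G) degree v = #|D|)%N.
  rewrite -sum1_card (eq_bigl (fun p : G * G => adj p.1 p.2)) => [|p];
    last by rewrite inE.
  rewrite -(pair_big_dep xpredT (fun v w : G => adj v w) (fun _ _ => 1%N)) /=.
  by apply: eq_bigr => v _; rewrite /degree -sum1_card; apply: eq_bigl => w; rewrite inE.
pose h (p : G * G) := ([set p.1; p.2]%SET, (enum_rank p.1 < enum_rank p.2)%N).
have h_inj : {in D &, injective h}.
  move=> [v w] [v' w']; rewrite !inE /= => vw vw' [/setP e].
  have neq (y z : G) : adj y z -> z != y by apply: contraTneq => ->; rewrite adj_irrefl.
  have := e v; have := e w; rewrite !inE !eqxx orbT /=.
  move=> /esym/orP[]/eqP ew /esym/orP[]/eqP ev; subst v w => //.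
  - by rewrite adj_irrefl in vw.
  - move=> lt; exfalso; have := neq _ _ vw'; rewrite -(inj_eq enum_rank_inj) -val_eqE /=.
    by move: lt; case: ltngtP.
  - by rewrite adj_irrefl in vw.
have -> : (2 * #|edges G| = #|setX (edges G) [set: bool]|)%N.
  by rewrite cardsX cardsT card_bool mulnC.
rewrite -(card_in_imset h_inj); apply: subset_leq_card.
apply/subsetP => _ /imsetP[[v w] vw ->]; rewrite !inE andbT.
by apply/existsP; exists v; apply/existsP; exists w; move: vw; rewrite inE /= => ->;
  rewrite eqxx.
Qed.

Section Subgraphs.
Variable G : sgraph.
Implicit Types (u v : G) (p : seq G).

(* Only the third path may have length 1. *)
Definition theta_in u v p1 p2 p3 : Prop :=
  [/\ uniq (u :: v :: p1 ++ p2 ++ p3), path (@adj G) u (rcons p1 v),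
      path (@adj G) u (rcons p2 v), path (@adj G) u (rcons p3 v)
    & (0 < size p1)%N && (0 < size p2)%N].

Definition infinity_in u v p1 p2 p3 : Prop :=
  [/\ uniq (u :: v :: p1 ++ p2 ++ p3), path (@adj G) u (rcons p1 u),
      path (@adj G) v (rcons p2 v), path (@adj G) u (rcons p3 v)
    & (1 < size p1)%N && (1 < size p2)%N].

Definition eight_in u p1 p2 : Prop :=
  [/\ uniq (u :: p1 ++ p2), path (@adj G) u (rcons p1 u),
      path (@adj G) u (rcons p2 u) & (1 < size p1)%N && (1 < size p2)%N].

Lemma theta_inC12 u v p1 p2 p3 :
  theta_in u v p1 p2 p3 -> theta_in u v p2 p1 p3.
Proof.
move=> [U P1 P2 P3 /andP[S1 S2]]; split; rewrite ?S1 ?S2 //.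
by rewrite -(perm_uniq (s1 := u :: v :: p1 ++ p2 ++ p3)) // !perm_cons perm_catCA.
Qed.

Lemma theta_inC23 u v p1 p2 p3 : (0 < size p3)%N ->
  theta_in u v p1 p2 p3 -> theta_in u v p1 p3 p2.
Proof.
move=> S3 [U P1 P2 P3 /andP[S1 S2]]; split; rewrite ?S1 ?S3 //.
rewrite -(perm_uniq (s1 := u :: v :: p1 ++ p2 ++ p3)) // !perm_cons.
by rewrite perm_cat2l perm_catC.
Qed.

Lemma rev_path_adj u p : path (@adj G) (last u p) (rev (belast u p)) = path (@adj G) u p.
Proof. by rewrite rev_path; apply: eq_path => x y; exact: adj_sym. Qed.

Lemma path_adj_rcons_rev u v p :
  path (@adj G) v (rcons (rev p) u) = path (@adj G) u (rcons p v).
Proof. by rewrite -[RHS]rev_path_adj last_rcons belast_rcons rev_cons. Qed.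

(** * Breadth-first forests and the cycles closed by extra edges *)

Fixpoint ball (X : {set G}) (k : nat) : {set G} :=
  if k is k'.+1 then
    ball X k' :|: [set v | [exists w in ball X k', adj v w]]
  else X.

(** A vertex already reached at a lower level keeps the path chosen there. This stability in [k]
    makes the paths of different vertices fit together into a forest. *)
Fixpoint ball_path (X : {set G}) (k : nat) v : seq G :=
  if k is k'.+1 then
    if v \in ball X k' then ball_path X k' v
    else if [pick w in ball X k' | adj v w] is Some w
         then w :: ball_path X k' w else [::]
  else [::].

(** A spanning forest rooted at [X]: [P v] is the path from [v] to its root without [v] itself, so
    [head v (P v)] is the parent. Keeping whole paths allows induction on their size. *)
Definition forest_towards (X : {set G}) (P : G -> seq G) : Prop :=
  forall v, if v \in X then P v = [::] else exists2 w, adj v w & P v = w :: P w.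

Lemma exists_forest_towards (X : {set G}) x0 :
  connected_graph G -> x0 \in X -> exists P, forest_towards X P.
Proof.
move=> Gc x0X.
have subX k v : v \in X -> v \in ball X k.
  by elim: k => //= k IH /IH; rewrite inE => ->.
have ball_le k m v : v \in ball X k -> v \in ball X (k + m).
  by elim: m => [|m IH]; rewrite ?addn0 ?addnS //= inE => /IH ->.
have inball v : exists k, v \in ball X k.
  have /connectP[p vp lp] := Gc v x0.
  exists (size p); elim: p v vp lp => [v _ /= <- //|w p IH v] /=.
  case/andP=> vw wp lp; rewrite !inE; apply/orP; right.
  by apply/existsP; exists w; rewrite vw IH.
have [N allN] : exists N, forall v, v \in ball X N.
  have [g gP] := fin_all_exists inball.
  by exists (\max_v g v) => v; rewrite -(subnKC (leq_bigmax v)); apply/ball_le/gP.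
exists (ball_path X N) => v; have := allN v; clear.
case: ifPn => [vX _|vX].
  by elim: N => //= k ->; rewrite (_ : v \in ball X k = true)//; elim: k => //= k;
    rewrite inE => ->.
(* Membership of [w] in the ball carries the induction: it makes the paths of [w] at levels [k] and
   [k.+1] agree. *)
suff: v \in ball X N -> exists2 w, adj v w & w \in ball X N /\
    ball_path X N v = w :: ball_path X N w.
  by move=> h /h[w vw [_ e]]; exists w.
elim: N => [|k IH] /=; first by rewrite (negPf vX).
rewrite inE; case: (boolP (v \in ball X k)) => [vk _|vk /=].
  have [w vw [wk e]] := IH vk; exists w => //.
  by rewrite inE wk.
rewrite inE => /existsP[w0 w0P]; case: pickP => [w /andP[wk vw]|/(_ w0)].
  by exists w => //; rewrite inE wk.
by rewrite w0P.
Qed.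

Section Forest.
Variables (X : {set G}) (P : G -> seq G).
Hypothesis forestP : forest_towards X P.

Lemma forest_in v : v \in X -> P v = [::].
Proof. by move=> vX; have := forestP v; rewrite vX. Qed.

Lemma forest_notin v : v \notin X -> exists2 w, adj v w & P v = w :: P w.
Proof. by move=> vX; have := forestP v; rewrite (negPf vX). Qed.

Lemma forest_ind (Q : G -> Prop) :
  (forall v, v \in X -> Q v) ->
  (forall v w, v \notin X -> adj v w -> P v = w :: P w -> Q w -> Q v) ->
  forall v, Q v.
Proof.
move=> Q0 QS v; move: {2}(size (P v)) (leqnn (size (P v))) => k.
elim: k v => [|k IH] v; case: (boolP (v \in X)) => [vX|vX]; try by move=> _; apply: Q0.
  by have [w _ ->] := forest_notin vX.
have [w vw e] := forest_notin vX; rewrite e ltnS => /IH; exact: QS vX vw e.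
Qed.

Lemma forest_suffix v w : w \in v :: P v -> exists a, v :: P v = a ++ w :: P w.
Proof.
elim/forest_ind: v => [v vX|v z vX vz e IH].
  by rewrite forest_in// inE => /eqP ->; exists [::]; rewrite forest_in.
rewrite inE => /orP[/eqP->|]; first by exists [::].
by rewrite e => /IH[a ->]; exists (v :: a).
Qed.

Lemma forest_path v : path (@adj G) v (P v).
Proof.
by elim/forest_ind: v => [v /forest_in->//|v z vX vz e IH]; rewrite e /= vz.
Qed.

Lemma forest_last v : last v (P v) \in X.
Proof.
by elim/forest_ind: v => [v /forest_in->//|v z vX vz e IH]; rewrite e.
Qed.

Lemma forest_belast v w : w \in belast v (P v) -> w \notin X.
Proof.
elim/forest_ind: v => [v /forest_in->//|v z vX vz e IH]; rewrite e /=.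
by rewrite inE => /orP[/eqP->|].
Qed.

Lemma forest_uniq v : uniq (v :: P v).
Proof.
elim/forest_ind: v => [v /forest_in->//|v z vX vz e IH].
rewrite cons_uniq e IH andbT; apply/negP => /forest_suffix[a /(congr1 size)].
by rewrite e size_cat /=; lia.
Qed.

(** The forest has at most one edge per vertex outside [X], so together with [E] it cannot exhaust
    the edges. The last two conditions say that neither end is the parent of the other. *)
Lemma extra_edge (E : {set {set G}}) :
  (#|E| + #|G| < #|edges G| + #|X|)%N ->
  exists x y, [/\ adj x y, [set x; y]%SET \notin E,
    x \notin X -> P x <> y :: P y & y \notin X -> P y <> x :: P x].
Proof.
move=> lt_E; pose T := [set [set v; head v (P v)]%SET | v in ~: X].
have cT : (#|T| <= #|~: X|)%N by apply: leq_imset_card.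
have : ~~ (edges G \subset E :|: T).
  apply/negP => /subset_leq_card; have := cardsC X.
  have : (#|E :|: T| <= #|E| + #|T|)%N by rewrite cardsU leq_subr.
  lia.
case/subsetPn => e; rewrite inE => /existsP[x /existsP[y /andP[xy /eqP->]]].
rewrite inE negb_or => /andP[arm_excessE eT]; exists x, y; split => // [xX e'|yX e'].
  by case/negP: eT; apply/imsetP; exists x; rewrite ?inE// e'.
by case/negP: eT; apply/imsetP; exists y; rewrite ?inE// e' setUC.
Qed.

(* The forest paths of the two ends of an extra edge either stay disjoint or
   close up, at their first meeting point [w], to a cycle through [w]. *)
Lemma forest_meet x y : adj x y ->
  (x \notin X -> P x <> y :: P y) -> (y \notin X -> P y <> x :: P x) ->
  [disjoint x :: P x & y :: P y] \/
  exists w c, [/\ path (@adj G) w (rcons c w), (1 < size c)%N,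
    uniq (c ++ w :: P w) & {in c, forall z, z \notin X}].
Proof.
move=> xy nxy nyx; case: (boolP (has (mem (y :: P y)) (x :: P x))); last first.
  by left; rewrite disjoint_has.
case/split_first => p1 [w [p2 [xE wy p1y]]]; right.
have [b yE] := forest_suffix wy.
have wx : w \in x :: P x by rewrite xE mem_cat mem_head orbT.
have [a xE'] := forest_suffix wx.
have {p2 xE' a wx} xE : x :: P x = p1 ++ w :: P w.
  rewrite xE'; congr (_ ++ _); apply: (@cat_cons_inj _ w _ _ (P w) p2).
    by rewrite -xE' forest_uniq.
  by rewrite -xE' xE.
have ux := forest_uniq x; have uy := forest_uniq y.
have prefixN z v c : v :: P v = c ++ w :: P w -> z \in c -> z \notin X.
  move=> e zc; apply: (@forest_belast v).
  have := forest_uniq v; have : z \in v :: P v by rewrite e mem_cat zc.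
  rewrite lastI mem_rcons inE => /orP[/eqP zl|//].
  have : z \in w :: P w.
    have -> : z = last v (v :: P v) by rewrite zl.
    by rewrite e last_cat /= mem_last.
  by move=> zw; rewrite -lastI e cat_uniq => /and3P[_ /hasPn/(_ z zw)/=]; rewrite zc.
have xp := forest_path x; have yp := forest_path y.
exists w, (rev p1 ++ b); split; last first.
- by move=> z; rewrite mem_cat mem_rev => /orP[]; apply: prefixN; [exact: xE|exact: yE].
- move: ux uy; rewrite xE yE -catA [uniq (rev _ ++ _)]cat_uniq cat_uniq rev_uniq.
  case/and3P=> -> _ _ -> /=; rewrite andbT -all_predC; apply/allP => z.
  rewrite -yE /= mem_rev => zy; apply/negP => zp; case/hasP: p1y.
  by exists z.
(* The cycle has at least three vertices: with fewer than two vertices in [c], either [x = y] or one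
   end would be the parent of the other. *)
- case: p1 xE p1y => [|x1 p1] xE p1y; case: b yE => [|y1 b] yE //=.
  + by move: xE yE xy => [-> _] [-> _]; rewrite adj_irrefl.
  + case: b yE => //= -[_ eP]; exfalso; apply: nyx.
      by apply: (prefixN _ y [:: y]); rewrite ?mem_head //= eP.
    by rewrite eP; case: xE => <- _.
  + case: p1 xE p1y => [|x2 p1]; last by rewrite cats0 size_rev.
    move=> /= -[_ eP] _; exfalso; apply: nxy.
      by apply: (prefixN _ x [:: x]); rewrite ?mem_head //= eP.
    by rewrite eP; case: yE => <- _.
  + by rewrite size_cat size_rev /= addSn addnS.
rewrite rcons_cat cat_path; apply/andP; split.
  case: p1 xE p1y => //= x1 p1 [e eP] _; subst x1.
  rewrite rev_cons path_adj_rcons_rev; move: xp; rewrite eP -cat_rcons cat_path.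
  by case/andP.
have -> : last w (rev p1) = x.
  by case: p1 xE p1y => [[]//|x1 p1 [-> _] _]; rewrite rev_cons last_rcons.
case: b yE => [[<- _]|y1 b [<- eP]] /=; rewrite xy //=.
by move: yp; rewrite eP -cat_rcons cat_path; case/andP.
Qed.

End Forest.
(** With a single root [r] both forest paths end at [r], so the disjoint alternative of
    [forest_meet] cannot occur. *)
Lemma exists_cycle : connected_graph G -> (0 < #|G|)%N ->
  (#|G| <= #|edges G|)%N ->
  exists w c, [/\ path (@adj G) w (rcons c w), (1 < size c)%N & uniq (w :: c)].
Proof.
move=> Gc /card_gt0P[r _] le_e.
have [P forP] := exists_forest_towards Gc (set11 r).
have [|x [y [xy _ nx ny]]] := @extra_edge [set r] P set0.
  by rewrite cards0 cards1 add0n addn1 ltnS.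
have [|[w [c [cp c2 cu _]]]] := forest_meet forP xy nx ny.
  have := forest_last forP x; have := forest_last forP y.
  rewrite !inE => /eqP ly /eqP lx; rewrite disjoint_has => /hasPn/(_ r).
  by rewrite -{1}lx mem_last /= -ly mem_last => /(_ isT).
exists w, c; split => //; move: cu; rewrite -cat_rcons cat_uniq => /andP[].
by rewrite rcons_uniq.
Qed.

(** Fix a cycle [C], a forest towards it and an edge in neither. If the forest paths of its ends are
    disjoint, they reach [C] at two vertices and form a third path beside the two arcs. Otherwise
    they close a second cycle that avoids [C] except possibly at its vertex [v]: an eight if [v] is
    on [C], else an infinity connected by the forest path of [v]. *)
Theorem exists_bicyclic_subgraph : connected_graph G -> (0 < #|G|)%N ->
  (#|G| < #|edges G|)%N ->
  [\/ exists u v p1 p2 p3, theta_in u v p1 p2 p3,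
      exists u v p1 p2 p3, infinity_in u v p1 p2 p3
    | exists u p1 p2, eight_in u p1 p2].
Proof.
move=> Gc G0 lt_e; have [w [c [wc c2 uc]]] := exists_cycle Gc G0 (ltnW lt_e).
pose C := [set z in w :: c].
pose E := [set [set z; next (w :: c) z]%SET | z in C].
have [P forP] : exists P, forest_towards C P.
  by apply: (@exists_forest_towards _ w) => //; rewrite inE mem_head.
have [|x [y [xy xyE nx ny]]] := @extra_edge C P E.
  by rewrite addnC -addSn leq_add ?leq_imset_card.
have rotC u0 : u0 \in C -> exists c', [/\ path (@adj G) u0 (rcons c' u0),
    uniq (u0 :: c'), w :: c =i u0 :: c', size c' = size c
    & next (w :: c) =1 next (u0 :: c')].
  rewrite inE => /rot_to[i c' e]; exists c'.
  have cyc : cycle (@adj G) (w :: c) by [].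
  have uc' : uniq (u0 :: c') by rewrite -e rot_uniq.
  split=> //.
  - by have := cyc; rewrite -(rot_cycle i) e.
  - by move=> z; rewrite -e mem_rot.
  - by have /(congr1 size) := e; rewrite size_rot => -[].
  - by move=> z; rewrite -e next_rot.
have [dis|[v [d [dp d2 du dC]]]] := forest_meet forP xy nx ny; last first.
  have lC := forest_last forP v.
  have dC' z : z \in C -> z \notin d by apply: contraL => /dC.
  have [c' [c'p uc' memc szc _]] := rotC _ lC.
  have inC z : (z \in C) = (z \in last v (P v) :: c') by rewrite inE memc.
  case: (boolP (v \in C)) => vC.
    have Pv := forest_in forP vC; rewrite Pv /= in c'p uc' inC lC.
    apply: Or33; exists v, c', d; split; rewrite ?szc ?c2 //=.
    case/andP: uc' => vc' uc'; move: du; rewrite Pv cats1 rcons_uniq => /andP[vd ud].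
    rewrite mem_cat negb_or vc' vd cat_uniq uc' ud /= andbT; apply/hasPn => z zd /=.
    by apply: contra (dC z zd) => zc; rewrite inC inE zc orbT.
  apply: Or32; have [v1 vv1 Pv] := forest_notin forP vC.
  have qC := @forest_belast _ _ forP v; have vp := forest_path forP v.
  set u0 := last v (P v) in lC c'p uc' inC; set q := behead (belast v (P v)).
  have Pvq : P v = rcons q u0 by rewrite /q /u0 Pv /= -lastI.
  rewrite Pvq belast_rcons in qC.
  exists u0, v, c', d, (rev q).
  split; rewrite ?szc ?c2 //; last by rewrite path_adj_rcons_rev -Pvq.
  rewrite (@perm_uniq _ _ (c' ++ (d ++ v :: P v))); last first.
    apply/permP => a; rewrite Pvq /= -cats1 !count_cat /= !count_cat /= count_rev.
    by clear; lia.
  move: uc'; rewrite cons_uniq => /andP[u0c' uc']; rewrite cat_uniq uc' du andbT /=.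
  apply/hasPn => z; rewrite mem_cat Pvq -rcons_cons mem_rcons inE /=.
  have c'C : z \in c' -> z \in C by move=> zc; rewrite inC inE zc orbT.
  case/or3P => [/dC zC|/eqP ->//|/qC zC]; exact: contra c'C zC.
set px := P x in dis *; set py := P y in dis *.
pose u := last x px; pose v := last y py.
have uC : u \in C by apply: forest_last forP x.
have vC : v \in C by apply: forest_last forP y.
have [c' [c'p uc' memc szc nextc]] := rotC _ uC.
have inC z : (z \in C) = (z \in u :: c') by rewrite inE memc.
have uv : v != u.
  apply: contraTneq dis => e; rewrite disjoint_has negbK; apply/hasP.
  by exists u; rewrite /= /u ?mem_last // -/u -e mem_last.
have : v \in c' by move: vC; rewrite inC inE (negPf uv).
move=> vc'; case/splitPr: vc' c'p uc' szc nextc inC {memc} => c1 c2'.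
rewrite rcons_cat rcons_cons -cat_rcons cat_path last_rcons.
move=> /andP[c1p c2p] uc' szc nextc inC.
pose p3 := rev (belast x px) ++ belast y py.
have p3p : path (@adj G) u (rcons p3 v).
  rewrite rcons_cat -lastI cat_path rev_path_adj (forest_path forP) /=.
  have -> : last u (rev (belast x px)) = x.
    by rewrite /u; case: (px) => //= z s; rewrite rev_cons last_rcons.
  by rewrite xy (forest_path forP).
have p3C z : z \in p3 -> z \notin C.
  by rewrite mem_cat mem_rev => /orP[] /(forest_belast forP).
have up3 : uniq p3.
  have := forest_uniq forP x; have := forest_uniq forP y.
  rewrite lastI rcons_uniq => /andP[_ uy]; rewrite lastI rcons_uniq => /andP[_ ux].
  rewrite cat_uniq rev_uniq ux uy andbT /=; apply/hasPn => z zy; rewrite /= mem_rev.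
  apply: contraTN dis => zx; rewrite disjoint_has negbK; apply/hasP; exists z.
    exact: mem_belast zx.
  exact: mem_belast zy.
(* An empty [p3] means that [x y] is a chord of [C]; as it is not an edge of [C], both arcs have
   inner vertices. *)
have p3_0 : p3 = [::] -> (0 < size c1)%N && (0 < size c2')%N.
  rewrite /p3 => p0; have [ex ey] : x = u /\ y = v.
    move/(congr1 size): p0; rewrite size_cat size_rev !size_belast /u /v.
    by case: (px); case: (py).
  move: xyE; rewrite ex ey; apply: contraR; rewrite negb_and -!eqn0Ngt !size_eq0.
  case/orP => /eqP e0; apply/imsetP.
    by exists u; rewrite // nextc e0 next_nth mem_head /= eqxx.
  exists v; rewrite // nextc e0 next_nth inE mem_cat mem_seq1 eqxx !orbT /=.
  rewrite eq_sym (negPf uv) index_cat.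
  move: uc'; rewrite e0 /= cats1 rcons_uniq => /and3P[_ vc1 _].
  by rewrite (negPf vc1) /= eqxx addn0 nth_default ?size_rcons 1?setUC.
have U : uniq (u :: v :: c1 ++ rev c2' ++ p3).
  rewrite (@perm_uniq _ _ ((u :: c1 ++ v :: c2') ++ p3)); last first.
    apply/permP => a; rewrite /= !(count_cat, count_rev) /= ?count_cat.
    by clear; lia.
  rewrite cat_uniq uc' up3 andbT; apply/hasPn => z /p3C.
  by apply: contra => zc; rewrite inC.
apply: Or31; exists u, v.
have c2p' : path (@adj G) u (rcons (rev c2') v) by rewrite path_adj_rcons_rev.
(* At most one of the three paths is a single edge; it is moved to the third place, the only one
   where [theta_in] admits it. *)
case: (posnP (size c1)) => [c10|c1_gt0].
  exists (rev c2'), p3, c1; split => //.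
    rewrite (@perm_uniq _ _ (u :: v :: c1 ++ rev c2' ++ p3)) //.
    by apply/permP => a; rewrite /= !count_cat; clear; lia.
  have c2_gt0 : (0 < size c2')%N by move: c2; rewrite -szc size_cat c10.
  rewrite size_rev c2_gt0; move: p3_0; rewrite c10.
  by case: (p3) => [|? ?] //= /(_ erefl).
case: (posnP (size c2')) => [c20|c2_gt0].
  exists c1, p3, (rev c2'); split => //.
    rewrite (@perm_uniq _ _ (u :: v :: c1 ++ rev c2' ++ p3)) //.
    by apply/permP => a; rewrite /= !count_cat; clear; lia.
  move: p3_0; rewrite c20 andbF c1_gt0.
  by case: (p3) => [|? ?] //= /(_ erefl).
by exists c1, (rev c2'), p3; split => //; rewrite c1_gt0 size_rev.
Qed.

End Subgraphs.

(** * Graphs given by walks *)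

Lemma infix2_zip (T : eqType) (a b : T) (w : seq T) :
  infix [:: a; b] w -> (a, b) \in zip w (behead w).
Proof.
case/infixP => p [s ->]; elim: p => [|c p IH] /=; first by rewrite mem_head.
by case: p IH => [|d p] /= IH; rewrite inE IH orbT.
Qed.

Lemma infix2_sorted (T : eqType) (e : rel T) (a b : T) (w : seq T) :
  infix [:: a; b] w -> sorted e w -> e a b.
Proof.
by case/infixP => p [s ->]; rewrite sorted_cat_cons /= => /and3P[].
Qed.

Lemma path_neq (T : eqType) (x : T) p : uniq (x :: p) -> path (fun y z => y != z) x p.
Proof. by rewrite uniq_pairwise => /pairwise_sorted. Qed.

Lemma cycle_neq (T : eqType) (x : T) p : uniq (x :: p) -> (0 < size p)%N ->
  path (fun y z => y != z) x (rcons p x).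
Proof.
move=> U p0; rewrite rcons_path path_neq//=; case/andP: U => xp _.
by apply: contraNneq xp => {1}<-; case: p p0 => //= z p _; apply: mem_last.
Qed.

Section WalkGraphs.
Variables (n : nat) (ws : seq (seq nat)).
Local Notation W := (walk_graph n ws).

(** Only an upper bound, as pairs may coincide. For the two concrete graphs equality comes later
    from their degrees, in [exact_degree]. *)
Lemma card_edges_walk_graph :
  (#|edges W| <= \sum_(w <- ws) (size w).-1)%N.
Proof.
pose E := [seq [set i : W | (val i == c.1) || (val i == c.2)]%SET
          | c <- flatten [seq zip w (behead w) | w <- ws]].
have sE : size E = (\sum_(w <- ws) (size w).-1)%N.
  rewrite size_map size_flatten sumnE /shape -map_comp big_map; apply: eq_bigr => w _ /=.
  by rewrite size_zip size_behead; apply/minn_idPr; apply: leq_pred.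
rewrite -sE; apply: leq_trans (card_size E); apply: subset_leq_card.
apply/subsetP => e; rewrite inE => /existsP[x /existsP[y /andP[/andP[_ /hasP[w ww
  xy]] /eqP ->]]].
have mem_E c : c \in zip w (behead w) ->
    [set i : W | (val i == c.1) || (val i == c.2)]%SET \in E.
  by move=> cw; apply: map_f; apply/flattenP; exists (zip w (behead w)) => //;
    apply: map_f.
case/orP: xy => /infix2_zip /mem_E /=.
  by rewrite (_ : [set _ | _] = [set x; y])//; apply/setP => i; rewrite !inE.
by rewrite (_ : [set _ | _] = [set x; y])//; apply/setP => i; rewrite !inE orbC.
Qed.

Lemma walk_graph_path (x : W) (p : seq W) :
  map val (x :: p) \in ws -> path (fun i j => i != j) x p -> path (@adj W) x p.
Proof.
move=> xp_ws; have go w : w \in ws -> forall y s, infix (map val (y :: s)) w ->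
    path (fun i j : W => i != j) y s -> path (@adj W) y s.
  move=> ww y s; elim: s y => //= z s IH y yw /andP[yz zs].
  apply/andP; split; last first.
    apply: IH zs; case/infixP: yw => a [c ->]; apply/infixP.
    by exists (rcons a (val y)), c; rewrite cat_rcons.
  rewrite /walk_adj yz /=; apply/hasP; exists w => //.
  case/infixP: yw => a [c ->]; apply/orP; left; apply/infixP.
  by exists a, (map val s ++ c).
exact: go xp_ws _ _ (infix_refl _).
Qed.

Lemma walk_graph_hom (G : sgraph) (h : nat -> G) :
  all (fun w => sorted (@adj G) (map h w)) ws ->
  forall i j : W, adj i j -> adj (h (val i)) (h (val j)).
Proof.
move=> /allP hom i j /andP[_ /hasP[w ww ij]].
have go a b : infix [:: a; b] w -> adj (h a) (h b).
  case/infixP => p [s wE]; move: (hom w ww); rewrite wE map_cat.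
  by apply: infix2_sorted; apply/infixP; exists (map h p), (map h s).
by case/orP: ij => /go //; rewrite adj_sym.
Qed.

Lemma lift_ord_seq (w : seq nat) :
  all (fun i => i < n)%N w -> exists w' : seq W, map val w' = w.
Proof.
elim: w => [_|i w IH /= /andP[i_n /IH[w' <-]]]; first by exists [::].
by exists ((Ordinal i_n : W) :: w').
Qed.

End WalkGraphs.

(** The map induced on edges is injective, hence onto by the equality of cardinals, so [h] also
    reflects adjacency. *)
Lemma iso_of_bijective_hom (G H : sgraph) (h : H -> G) :
  bijective h -> (forall x y, adj x y -> adj (h x) (h y)) ->
  #|edges H| = #|edges G| -> graph_iso G H.
Proof.
move=> h_bij hom cE; have h_inj := bij_inj h_bij; case: (h_bij) => k hk kh.
have imE : [set h @: (e : {set H}) | e in edges H]%SET = edges G.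
  apply/eqP; rewrite eqEcard card_imset ?cE ?leqnn ?andbT; last exact: imset_inj.
  apply/subsetP => _ /imsetP[e arm_excessE ->]; move: arm_excessE; rewrite !inE.
  case/existsP => x /existsP[y /andP[xy /eqP ->]].
  apply/existsP; exists (h x); apply/existsP; exists (h y).
  by rewrite hom //= imsetU !imset_set1.
exists k; first by exists h.
move=> x y; rewrite -[in RHS](kh x) -[in RHS](kh y).
move: (k x) (k y) => {}x {}y; apply/idP/idP => [|hxy]; first exact: hom.
have : [set h x; h y]%SET \in edges G.
  by rewrite inE; apply/existsP; exists (h x); apply/existsP; exists (h y);
    rewrite hxy /=.
rewrite -imE => /imsetP[e]; rewrite inE => /existsP[a /existsP[b /andP[ab /eqP ->]]].
rewrite imsetU !imset_set1 => /setP E.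
have := E (h x); have := E (h y); have := E (h a); have := E (h b).
rewrite !inE !eqxx !orbT /= !(inj_eq h_inj).
have xy : x != y by apply: contraTneq hxy => ->; rewrite adj_irrefl.
move=> /orP[/eqP eb|/eqP eb] /orP[/eqP ea|/eqP ea]; subst a b;
  rewrite ?adj_irrefl // in ab *.
by rewrite adj_sym.
Qed.

(** * Connectivity and recognition of the two concrete families *)

Lemma arm_connect (G : sgraph) (u v : G) p : path (@adj G) u (rcons p v) ->
  {in v :: p, forall w, connect (@adj G) u w}.
Proof.
move=> pp w wp; apply: (path_connect pp).
by rewrite inE mem_rcons wp orbT.
Qed.

Lemma connect_adjC (G : sgraph) : connect_sym (@adj G).
Proof. exact/sym_connect_sym/adj_sym. Qed.

Lemma connected_from (G : sgraph) (u : G) :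
  (forall w, connect (@adj G) u w) -> connected_graph G.
Proof. by move=> h x y; apply: connect_trans (h y); rewrite connect_adjC. Qed.

Lemma theta_connected (G : sgraph) (u v : G) p1 p2 p3 :
  theta_in u v p1 p2 p3 -> (forall w, w \in u :: v :: p1 ++ p2 ++ p3) ->
  connected_graph G.
Proof.
move=> [_ /arm_connect c1 /arm_connect c2 /arm_connect c3 _] cov.
apply: (@connected_from _ u) => w; have := cov w; rewrite !inE !mem_cat.
case/or3P => [/eqP->|/eqP->|/or3P[] wp]; first exact: connect0.
- by apply: c1; rewrite mem_head.
- by apply: c1; rewrite inE wp orbT.
- by apply: c2; rewrite inE wp orbT.
- by apply: c3; rewrite inE wp orbT.
Qed.

Lemma infinity_connected (G : sgraph) (u v : G) p1 p2 p3 :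
  infinity_in u v p1 p2 p3 -> (forall w, w \in u :: v :: p1 ++ p2 ++ p3) ->
  connected_graph G.
Proof.
move=> [_ /arm_connect c1 /arm_connect c2 /arm_connect c3 _] cov.
have uv : connect (@adj G) u v by apply: c3; rewrite mem_head.
apply: (@connected_from _ u) => w; have := cov w; rewrite !inE !mem_cat.
case/or3P => [/eqP->|/eqP->//|/or3P[] wp]; first exact: connect0.
- by apply: c1; rewrite inE wp orbT.
- by apply: connect_trans uv _; apply: c2; rewrite inE wp orbT.
- by apply: c3; rewrite inE wp orbT.
Qed.

Section Concrete.
Variables l1 l2 l3 : nat.
Hypotheses (l1_gt0 : (0 < l1)%N) (l2_gt0 : (0 < l2)%N) (l3_gt0 : (0 < l3)%N).
Local Notation n := (l1 + l2 + l3 - 1)%N.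
Let i1 := iota 2 (l1 - 1).
Let i2 := iota (l1 + 1) (l2 - 1).
Let i3 := iota (l1 + l2) (l3 - 1).

Lemma iota_arms : 0%N :: 1%N :: i1 ++ i2 ++ i3 = iota 0 n.
Proof.
have -> : (n = 2 + ((l1 - 1) + ((l2 - 1) + (l3 - 1))))%N by lia.
rewrite !iotaD /i1 /i2 /i3 /=.
have -> : (2 + (l1 - 1) = l1 + 1)%N by lia.
by have -> : (l1 + 1 + (l2 - 1) = l1 + l2)%N by lia.
Qed.

Lemma concrete_vertices (ws : seq (seq nat)) :
  exists (u v : walk_graph n ws) p1 p2 p3,
  [/\ uniq (u :: v :: p1 ++ p2 ++ p3),
    [/\ val u = 0%N & val v = 1%N],
    [/\ map val p1 = i1, map val p2 = i2 & map val p3 = i3]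
  & [/\ (size p1).+1 = l1, (size p2).+1 = l2 & (size p3).+1 = l3]].
Proof.
have : all (fun i => i < n)%N (0%N :: 1%N :: i1 ++ i2 ++ i3).
  by rewrite iota_arms; apply/allP => i; rewrite mem_iota.
rewrite /= !all_cat => /and5P[n0 n1 /lift_ord_seq-/(_ ws)[p1 e1] /lift_ord_seq-/(_
  ws)[p2 e2] /lift_ord_seq-/(_ ws)[p3 e3]].
exists (Ordinal n0), (Ordinal n1), p1, p2, p3; split => //.
  have valE : map val ((Ordinal n0 : walk_graph n ws) :: Ordinal n1 :: p1 ++ p2 ++
    p3) = iota 0 n.
    by rewrite -iota_arms -e1 -e2 -e3 -!map_cat.
  by have := iota_uniq 0 n; rewrite -valE; apply: map_uniq.
have sz (p : seq (walk_graph n ws)) m l : map val p = iota m (l - 1) -> (0 < l)%N ->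
  (size p).+1 = l.
  by move=> /(congr1 size); rewrite size_map size_iota => ->; lia.
by split; [exact: sz e1 _|exact: sz e2 _|exact: sz e3 _].
Qed.

Variables (G : sgraph) (u v : G) (p1 p2 p3 : seq G).
Hypothesis U : uniq (u :: v :: p1 ++ p2 ++ p3).
Hypotheses (s1 : (size p1).+1 = l1) (s2 : (size p2).+1 = l2) (s3 : (size p3).+1 = l3).
Hypothesis card_G : #|G| = n.
Let L := u :: v :: p1 ++ p2 ++ p3.

Lemma map_nth_arms :
  [/\ map (nth u L) i1 = p1, map (nth u L) i2 = p2 & map (nth u L) i3 = p3].
Proof.
have take_drop i (a b c : seq G) : i = size a ->
    map (nth u (a ++ b ++ c)) (iota i (size b)) = b.
  move=> ->; rewrite map_nth_iota; last by rewrite !size_cat; clear; lia.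
  by rewrite drop_size_cat // take_size_cat.
rewrite /i1 /i2 /i3 -s1 -s2 -s3 !subn1 /=; split.
- exact: (take_drop _ [:: u; v]).
- have -> : L = (u :: v :: p1) ++ p2 ++ p3 by [].
  by apply: take_drop; rewrite /= addn1.
have -> : L = (u :: v :: p1 ++ p2) ++ p3 ++ [::] by rewrite cats0 /= -catA.
by apply: take_drop; rewrite /= size_cat addSn addnS.
Qed.

Lemma size_vertices : size L = n.
Proof. by rewrite /= !size_cat -s1 -s2 -s3; clear; lia. Qed.

(** The numbering of the concrete graphs lists [u], [v] and then the three arms in order, so the
    isomorphism sends [i] to the [i]-th entry of [L]. *)
Lemma concrete_iso (ws : seq (seq nat)) :
  all (fun w => sorted (@adj G) (map (nth u L) w)) ws ->
  #|edges (walk_graph n ws)| = #|edges G| -> graph_iso G (walk_graph n ws).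
Proof.
move=> hom cE; apply: (@iso_of_bijective_hom _ (walk_graph n ws) (fun i => nth u L
  (val i))) => //.
  apply: inj_card_bij; last by rewrite card_G card_ord.
  move=> i j /eqP; rewrite nth_uniq ?size_vertices ?ltn_ord// => /eqP e.
  exact: val_inj.
exact: walk_graph_hom.
Qed.

End Concrete.

Lemma theta_graph_structure (l1 l2 l3 : nat) :
  (1 < l1)%N -> (1 < l2)%N -> (0 < l3)%N ->
  exists (u v : theta_graph l1 l2 l3) p1 p2 p3, theta_in u v p1 p2 p3 /\
    [/\ (size p1).+1 = l1, (size p2).+1 = l2 & (size p3).+1 = l3].
Proof.
move=> g1 g2 g3; rewrite /theta_graph; set ws := [:: _; _; _].
have [u [v [p1 [p2 [p3 [U [eu ev] [e1 e2 e3] [s1 s2 s3]]]]]]] :=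
  concrete_vertices (ltnW g1) (ltnW g2) g3 ws.
exists u, v, p1, p2, p3; split => //; split => //; last by lia.
- apply: walk_graph_path.
    by rewrite /= map_rcons e1 eu ev -cats1 mem_head.
  apply: path_neq; rewrite -rcons_cons rcons_uniq.
  by move: U; rewrite /= !inE !mem_cat !cat_uniq !negb_or => /and3P[/and4P[uv -> _ _]
    /and3P[-> _ _] /and5P[-> _ _ _ _]]; rewrite eq_sym uv.
- apply: walk_graph_path.
    by rewrite /= map_rcons e2 eu ev -cats1 !inE eqxx orbT.
  apply: path_neq; rewrite -rcons_cons rcons_uniq.
  by move: U; rewrite /= !inE !mem_cat !cat_uniq !negb_or => /and3P[/and4P[uv _ -> _]
    /and3P[_ -> _] /and5P[_ _ -> _ _]]; rewrite eq_sym uv.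
- apply: walk_graph_path.
    by rewrite /= map_rcons e3 eu ev -cats1 !inE eqxx !orbT.
  apply: path_neq; rewrite -rcons_cons rcons_uniq.
  by move: U; rewrite /= !inE !mem_cat !cat_uniq !negb_or => /and3P[/and4P[uv _ _ ->]
    /and3P[_ _ ->] /and5P[_ _ _ _ ->]]; rewrite eq_sym uv.
Qed.

Lemma infinity_graph_structure (l1 l2 l3 : nat) :
  (2 < l1)%N -> (2 < l2)%N -> (0 < l3)%N ->
  exists (u v : infinity_graph l1 l2 l3) p1 p2 p3, infinity_in u v p1 p2 p3 /\
    [/\ (size p1).+1 = l1, (size p2).+1 = l2 & (size p3).+1 = l3].
Proof.
move=> g1 g2 g3; rewrite /infinity_graph; set ws := [:: _; _; _].
have [u [v [p1 [p2 [p3 [U [eu ev] [e1 e2 e3] [s1 s2 s3]]]]]]] :=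
  concrete_vertices (ltnW (ltnW g1)) (ltnW (ltnW g2)) g3 ws.
exists u, v, p1, p2, p3; split => //; split => //;
  last by rewrite -ltnS s1 g1 -ltnS s2 g2.
- apply: walk_graph_path.
    by rewrite /= map_rcons e1 eu -cats1 mem_head.
  apply: cycle_neq; last by rewrite -ltnS s1 ltnW.
  by move: U; rewrite /= !inE !mem_cat !cat_uniq !negb_or => /and3P[/and4P[_ -> _ _]
    _ /and5P[-> _ _ _ _]].
- apply: walk_graph_path.
    by rewrite /= map_rcons e2 ev -cats1 !inE eqxx orbT.
  apply: cycle_neq; last by rewrite -ltnS s2 ltnW.
  by move: U; rewrite /= !inE !mem_cat !cat_uniq !negb_or => /and3P[_ /and3P[_ -> _]
    /and5P[_ _ -> _ _]].
- apply: walk_graph_path.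
    by rewrite /= map_rcons e3 eu ev -cats1 !inE eqxx !orbT.
  apply: path_neq; rewrite -rcons_cons rcons_uniq.
  by move: U; rewrite /= !inE !mem_cat !cat_uniq !negb_or => /and3P[/and4P[uv _ _ ->]
    /and3P[_ _ ->] /and5P[_ _ _ _ ->]]; rewrite eq_sym uv.
Qed.

Lemma card_edges_theta_graph (l1 l2 l3 : nat) :
  (0 < l1)%N -> (0 < l2)%N -> (0 < l3)%N ->
  (#|edges (theta_graph l1 l2 l3)| <= l1 + l2 + l3)%N.
Proof.
move=> g1 g2 g3; apply: leq_trans (card_edges_walk_graph _ _) _.
by rewrite !big_cons big_nil /= !size_cat !size_iota /=; lia.
Qed.

Lemma card_edges_infinity_graph (l1 l2 l3 : nat) :
  (0 < l1)%N -> (0 < l2)%N -> (0 < l3)%N ->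
  (#|edges (infinity_graph l1 l2 l3)| <= l1 + l2 + l3)%N.
Proof.
move=> g1 g2 g3; apply: leq_trans (card_edges_walk_graph _ _) _.
by rewrite !big_cons big_nil /= !size_cat !size_iota /=; lia.
Qed.

Section Iso.
Variables (G : sgraph) (u v : G) (p1 p2 p3 : seq G) (l1 l2 l3 : nat).
Hypotheses (s1 : (size p1).+1 = l1) (s2 : (size p2).+1 = l2) (s3 : (size p3).+1 = l3).
Hypothesis card_G : #|G| = (l1 + l2 + l3 - 1)%N.

Lemma theta_iso : theta_in u v p1 p2 p3 ->
  #|edges (theta_graph l1 l2 l3)| = #|edges G| -> graph_iso G (theta_graph l1 l2 l3).
Proof.
move=> [U P1 P2 P3 _] cE; apply: (concrete_iso U s1 s2 s3 card_G _ cE).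
have [m1 m2 m3] := map_nth_arms u v s1 s2 s3.
by rewrite /= !map_cat m1 m2 m3 /= !cats1 P1 P2 P3.
Qed.

Lemma infinity_iso : infinity_in u v p1 p2 p3 ->
  #|edges (infinity_graph l1 l2 l3)| = #|edges G| ->
  graph_iso G (infinity_graph l1 l2 l3).
Proof.
move=> [U P1 P2 P3 _] cE; apply: (concrete_iso U s1 s2 s3 card_G _ cE).
have [m1 m2 m3] := map_nth_arms u v s1 s2 s3.
by rewrite /= !map_cat m1 m2 m3 /= !cats1 P1 P2 P3.
Qed.

End Iso.

Import Order.TTheory GRing.Theory Num.Theory.
Local Open Scope ring_scope.

(** * Spectral radius and Rayleigh quotients *)

Section SpectralRadius.
Local Open Scope sesquilinear_scope.

Lemma Re_norm_real_complex (R : realType) (r : R) :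
  complex.Re `|r%:C%C| = `|r|.
Proof. by rewrite normc_def /= expr0n addr0 sqrtr_sqr. Qed.

Lemma le_Re (R : realType) (x y : R[i]) : x <= y -> complex.Re x <= complex.Re y.
Proof. by rewrite lecE => /andP[]. Qed.

(** A supremum dominates its members only for a bounded set. Comparing l1-norms of an eigenvector
    bounds every modulus by the sum of the moduli of all entries. *)
Lemma eigenvalue_le_spectral_radius (R : realType) (m : nat) (A : 'M[R]_m)
  (z : R[i]) :
  eigenvalue (map_mx (real_complex R) A) z ->
  complex.Re `|z| <= spectral_radius A.
Proof.
move=> ev_z; apply: ub_le_sup; last by exists z.
pose B := map_mx (real_complex R) A.
pose M : R[i] := \sum_i \sum_j `|B i j|.
exists (complex.Re M) => _ [w /eigenvalueP[v vB vn0] <-].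
apply: le_Re.
have sv_gt0 : 0 < \sum_j `|v 0 j|.
  rewrite lt_def sumr_ge0 ?andbT//.
  apply: contraNneq vn0 => /eqP; rewrite psumr_eq0//= => /allP v0.
  apply/eqP/rowP => j; rewrite mxE; apply/eqP; rewrite -normr_eq0.
  by apply: v0; rewrite mem_index_enum.
rewrite -(ler_pM2r sv_gt0) mulr_sumr.
have -> : \sum_j `|w| * `|v 0 j| = \sum_j `|\sum_i v 0 i * B i j|.
  by apply: eq_bigr => j _; move/rowP/(_ j): vB; rewrite !mxE => ->; rewrite normrM.
apply: le_trans (_ : \sum_j \sum_i `|v 0 i| * `|B i j| <= _).
  apply: ler_sum => j _; apply: le_trans (ler_norm_sum _ _ _) _.
  by apply: ler_sum => i _; rewrite normrM.
rewrite exchange_big /= mulr_sumr; apply: ler_sum => i _.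
rewrite -mulr_sumr mulrC ler_wpM2r//.
rewrite /M [leRHS](bigD1 i)//= lerDl sumr_ge0// => k _; exact: sumr_ge0.
Qed.

(** For an eigenvector [v] of any complex eigenvalue [w], the triangle inequality in the l1-norm
    weighted by [x], with the symmetry of [A], gives |w| <= lam. *)
Lemma spectral_radius_positive (R : realType) (m : nat) (A : 'M[R]_m)
  (x : 'rV[R]_m) (lam : R) :
  A^T = A -> (forall i j, 0 <= A i j) -> (0 < m)%N ->
  (forall i, 0 < x 0 i) -> x *m A = lam *: x -> spectral_radius A = lam.
Proof.
move=> Asym A0 m0 x0 xA.
pose i0 := Ordinal m0.
have lam0 : 0 <= lam.
  have /rowP/(_ i0) := xA; rewrite !mxE => /esym e.
  rewrite -(pmulr_lge0 _ (x0 i0)) e sumr_ge0// => i _.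
  by rewrite mulr_ge0 ?A0 // ltW.
have ev : eigenvalue (map_mx (real_complex R) A) lam%:C%C.
  rewrite eigenvalue_map; apply/eigenvalueP; exists x => //.
  by apply/eqP => /rowP/(_ i0); rewrite mxE => e; move: (x0 i0); rewrite e ltxx.
apply/le_anti/andP; split; last first.
  have := eigenvalue_le_spectral_radius ev.
  by rewrite Re_norm_real_complex ger0_norm.
apply: ge_sup; first by exists (complex.Re `|lam%:C%C|), lam%:C%C.
move=> _ [w /eigenvalueP[v vB vn0] <-].
suff : `|w| <= lam%:C%C by move/le_Re.
pose X i := (x 0 i)%:C%C.
have X0 i : 0 < X i by rewrite ltcR.
have sv_gt0 : 0 < \sum_j `|v 0 j| * X j.
  rewrite lt_def sumr_ge0 ?andbT => [|j _]; last by rewrite mulr_ge0 ?normr_ge0 ?ltW.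
  apply: contraNneq vn0 => /eqP; rewrite psumr_eq0//= => [/allP v0|j _];
    last by rewrite mulr_ge0 ?normr_ge0 ?ltW.
  apply/eqP/rowP => j; rewrite mxE; apply/eqP; rewrite -normr_eq0.
  have := v0 j (mem_index_enum j); rewrite mulf_eq0 => /orP[//|/eqP e].
  by move: (X0 j); rewrite e ltxx.
rewrite -(ler_pM2r sv_gt0) !mulr_sumr.
have xA' i : \sum_j (A i j)%:C%C * X j = lam%:C%C * X i.
  have /rowP/(_ i) := xA; rewrite !mxE -!rmorphM /= => <-; rewrite rmorph_sum.
  by apply: eq_bigr => j _; rewrite -rmorphM mulrC -{1}Asym mxE.
apply: le_trans (_ : \sum_j \sum_i `|v 0 i| * (A i j)%:C%C * X j <= _).
  apply: ler_sum => j _; rewrite mulrA -mulr_suml ler_wpM2r ?(ltW (X0 _))//.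
  move/rowP/(_ j): vB; rewrite !mxE -normrM => <-.
  apply: le_trans (ler_norm_sum _ _ _) _; apply: ler_sum => i _.
  by rewrite normrM !mxE [X in _ * X <= _]ger0_norm ?lecR.
rewrite exchange_big /=; apply: ler_sum => i _.
under eq_bigr do rewrite -mulrA.
by rewrite -mulr_sumr xA' mulrCA.
Qed.

(* In an orthonormal eigenbasis the hypothesis reads
   [\sum_j (lam - d_j) |y_j|^2 <= 0] with every [d_j <= lam]. *)
Lemma rayleigh_max (R : realType) (m : nat) (A : 'M[R]_m) (x : 'rV[R]_m)
  (lam : R) :
  A^T = A -> spectral_radius A <= lam ->
  lam * (x *m x^T) 0 0 <= (x *m A *m x^T) 0 0 -> x *m A = lam *: x.
Proof.
move=> Asym rho_le ray.
pose B := map_mx (real_complex R) A; pose X := map_mx (real_complex R) x.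
have X_real : X^t* = X^T.
  by apply/matrixP => i j; rewrite !mxE; apply: conjc_real.
have Bherm : B \is hermsymmx.
  apply: realsym_hermsym.
    apply/is_hermitianmxP; rewrite expr0 scale1r; apply/matrixP => i j.
    by rewrite !mxE /= -[in LHS]Asym mxE.
  by apply/mxOverP => i j; rewrite !mxE; apply/complex_realP; exists (A i j).
have /mxOverP d_real := hermitian_spectral_diag_real Bherm.
have /hermitian_normalmx/orthomx_spectralP := Bherm.
have Pu := spectral_unitarymx B; have Pi := spectral_unit B.
rewrite invmx_unitary//.
set P := spectralmx B in Pu Pi *; set d := spectral_diag B in d_real *.
move=> Beq.
have PPt : P *m P^t* = 1%:M by apply/unitarymxP.
have PtP : P^t* *m P = 1%:M by apply: mulmx1C.
have d_le j : d 0 j <= lam%:C%C.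
  have ev : eigenvalue B (d 0 j).
    apply/eigenvalueP; exists (row j P).
      by rewrite -row_mul Beq !mulmxA PPt mul1mx row_mul row_diag_mx -scalemxAl -rowE.
    apply/eqP => r0; have /rowP/(_ j) : row j P *m P^t* = 0 by rewrite r0 mul0mx.
    by rewrite -row_mul PPt !mxE eqxx => /eqP; rewrite oner_eq0.
  have := eigenvalue_le_spectral_radius ev.
  have /complex_realP[k ->] := d_real 0 j.
  rewrite Re_norm_real_complex lecR => h.
  by apply: le_trans (ler_norm _) (le_trans h rho_le).
pose Y := X *m P^t*.
have YP : Y *m P = X by rewrite /Y -mulmxA PtP mulmx1.
have XB : X *m B = Y *m diag_mx d *m P by rewrite Beq !mulmxA.
have XX : X *m X^T = Y *m Y^t*.
  by rewrite -X_real -{1 2}YP trmx_mul map_mxM mulmxA -(mulmxA Y) PPt mulmx1.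
have XBX : X *m B *m X^T = Y *m diag_mx d *m Y^t*.
  rewrite XB -X_real -{1}YP trmx_mul map_mxM mulmxA.
  by rewrite -(mulmxA (Y *m diag_mx d)) PPt mulmx1.
have term j : 0 <= (lam%:C%C - d 0 j) * (Y 0 j * (Y 0 j)^*).
  by rewrite mulr_ge0 ?subr_ge0 ?mul_conjC_ge0.
have sum_eq0 : \sum_j (lam%:C%C - d 0 j) * (Y 0 j * (Y 0 j)^*) = 0.
  apply/le_anti/andP; split; last by apply: sumr_ge0 => j _.
  have -> : \sum_j (lam%:C%C - d 0 j) * (Y 0 j * (Y 0 j)^*) =
     lam%:C%C * (X *m X^T) 0 0 - (X *m B *m X^T) 0 0.
    rewrite XX XBX mul_mx_diag !mxE mulr_sumr -sumrB; apply: eq_bigr => j _.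
    by rewrite !mxE mulrBl; congr (_ - _); rewrite mulrA (mulrC (d _ _)).
  rewrite subr_le0 /X /B map_trmx -!map_mxM !mxE.
  by rewrite -rmorphM lecR; move: ray; rewrite !mxE.
have Yd j : Y 0 j * d 0 j = lam%:C%C * Y 0 j.
  move/eqP: sum_eq0; rewrite psumr_eq0// => /allP/(_ j (mem_index_enum j)).
  rewrite /= mulf_eq0 mul_conjC_eq0 => /orP[|/eqP->]; last by rewrite mul0r mulr0.
  by rewrite subr_eq0 => /eqP <-; rewrite mulrC.
have YD : Y *m diag_mx d = lam%:C%C *: Y.
  by rewrite mul_mx_diag; apply/rowP => j; rewrite mxE [RHS]mxE Yd.
have : X *m B = lam%:C%C *: X by rewrite XB YD -scalemxAl YP.
move=> /rowP e; apply/rowP => j; apply: complexI; move: (e j).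
by rewrite /X /B -map_mxM !mxE rmorphM.
Qed.

End SpectralRadius.

(** * The f-adjacency matrix acting on functions of the vertices *)

Lemma adj_degree_gt0 (G : sgraph) (v w : G) : adj v w -> (0 < degree v)%N.
Proof. by move=> vw; apply/card_gt0P; exists w; rewrite inE. Qed.

Lemma sum_enum_val (R : realType) (G : sgraph) (F : G -> R) :
  \sum_v F v = \sum_(i < #|G|) F (enum_val i).
Proof. exact: (reindex _ (onW_bij _ (enum_val_bij G))). Qed.

Section FAdjacency.
Variables (R : realType) (f : R -> R -> R).
Hypothesis f_gt0 : forall x y : R, 0 < x -> 0 < y -> 0 < f x y.
Hypothesis f_sym : forall x y : R, 0 < x -> 0 < y -> f x y = f y x.

Definition fadj_apply (G : sgraph) (x : G -> R) (v : G) : R :=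
  \sum_(w | adj v w) f (degree v)%:R (degree w)%:R * x w.

Lemma weight_gt0 (G : sgraph) (v w : G) :
  adj v w -> 0 < f (degree v)%:R (degree w)%:R.
Proof.
move=> vw; apply: f_gt0; rewrite ltr0n.
  exact: adj_degree_gt0 vw.
by rewrite adj_sym in vw; apply: adj_degree_gt0 vw.
Qed.

Lemma f_adjacency_sym (G : sgraph) : (f_adjacency f G)^T = f_adjacency f G.
Proof.
apply/matrixP => i j; rewrite !mxE adj_sym; case: ifP => // ij.
by rewrite f_sym// ltr0n; [rewrite adj_sym in ij|]; apply: adj_degree_gt0 ij.
Qed.

Lemma row_mul_f_adjacency (G : sgraph) (x : G -> R) j :
  ((\row_i x (enum_val i)) *m f_adjacency f G) 0 j =
  fadj_apply x (enum_val j).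
Proof.
rewrite mxE /fadj_apply [RHS]big_mkcond sum_enum_val /=.
apply: eq_bigr => i _.
rewrite -[in LHS]f_adjacency_sym !mxE mulrC; case: ifP => //.
by rewrite mul0r.
Qed.

Lemma rho_eqP (G : sgraph) (x : G -> R) (lam : R) (v0 : G) :
  (forall v, 0 < x v) -> (forall v, fadj_apply x v = lam * x v) ->
  rho f G = lam.
Proof.
move=> x_gt0 xE.
apply: (@spectral_radius_positive _ _ _ (\row_i x (enum_val i))).
- exact: f_adjacency_sym.
- by move=> i j; rewrite mxE; case: ifP => // /weight_gt0/ltW.
- by apply/card_gt0P; exists v0.
- by move=> i; rewrite mxE.
- by apply/rowP => j; rewrite row_mul_f_adjacency xE !mxE.
Qed.

(** The Rayleigh hypothesis is written as a sum over vertices so that it can be checked vertex by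
    vertex. *)
Lemma rho_rayleigh (G : sgraph) (x : G -> R) (lam : R) :
  rho f G <= lam -> 0 <= \sum_v (fadj_apply x v - lam * x v) * x v ->
  forall v, fadj_apply x v = lam * x v.
Proof.
move=> rho_le ray v; set X := \row_(i < #|G|) x (enum_val i).
have XA : X *m f_adjacency f G = lam *: X.
  apply: rayleigh_max => //; first exact: f_adjacency_sym.
  rewrite -subr_ge0; apply: le_trans ray _; rewrite le_eqVlt; apply/orP; left.
  apply/eqP; rewrite [in RHS]mxE [in X in _ - lam * X]mxE mulr_sumr -sumrB.
  rewrite sum_enum_val /=; apply: eq_bigr => i _.
  by rewrite row_mul_f_adjacency !mxE mulrBl !mulrA.
have /rowP/(_ (enum_rank v)) := XA.
by rewrite row_mul_f_adjacency !mxE enum_rankK.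
Qed.

Lemma le_fadj_apply (G : sgraph) (x : G -> R) (v : G) (s : seq G) :
  (forall w, 0 <= x w) -> uniq s -> {in s, forall w, adj v w} ->
  \sum_(w <- s) f (degree v)%:R (degree w)%:R * x w <= fadj_apply x v.
Proof.
move=> x_ge0 s_uniq s_adj.
rewrite big_uniq//= /fadj_apply big_mkcond [leRHS]big_mkcond /=.
apply: ler_sum => w _; have := s_adj w; case: ifP => [_ ->//|_ _].
by case: ifP => // /weight_gt0/ltW vw; rewrite mulr_ge0.
Qed.

End FAdjacency.

(** * The contribution of an arm *)

Section StrictlyConvexSequence.
Variables (R : realFieldType) (g : nat -> R).
Hypothesis g_convex : forall l, g l.+1 - g l.+2 < g l - g l.+1.

(** The chord over [m] and [m.+1] is a supporting line of a convex sequence. It touches at two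
    consecutive integers, which are the lengths in a balanced triple. *)
Lemma tangent_le m l : g m - (g m - g m.+1) * (l%:R - m%:R) <= g l.
Proof.
have mono i j : (i <= j)%N -> g j - g j.+1 <= g i - g i.+1.
  elim: j => [|j IH]; first by rewrite leqn0 => /eqP->.
  rewrite leq_eqVlt => /predU1P[->//|]; rewrite ltnS => /IH.
  exact/le_trans/ltW.
case: (leqP m l) => [/subnKC <-|/ltnW/subnKC e].
  elim: (l - m)%N => [|k IH]; first by rewrite addn0; lra.
  have := mono _ _ (leq_addr k m); move: IH; rewrite addnS -natr1; nra.
suff: forall k, (k <= m)%N -> g m + (g m - g m.+1) * k%:R <= g (m - k)%N.
  move=> /(_ (m - l)%N (leq_subr _ _)); rewrite -e addKn addnK.
  by rewrite natrD; nra.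
elim=> [|k IH] km; first by rewrite subn0; lra.
have := mono (m - k.+1)%N m (leq_subr _ _); move: (IH (ltnW km)).
rewrite (_ : (m - k.+1).+1 = m - k)%N -?natr1; [nra|lia].
Qed.

Lemma tangent_lt m l : l != m -> l != m.+1 ->
  g m - (g m - g m.+1) * (l%:R - m%:R) < g l.
Proof.
move=> lm lm1; case: (leqP l m) => h.
  have {lm}h : (l < m)%N by lia.
  have [m' em] : exists m', m = m'.+1 by case: m h {lm1} => // m' _; exists m'.
  subst m; have := tangent_le m' l; have := g_convex m'.
  have : l%:R <= m'%:R :> R by rewrite ler_nat.
  by rewrite -natr1; nra.
have {}h : (m.+2 <= l)%N by lia.
have := tangent_le m.+1 l; have := g_convex m.
have : m.+2%:R <= l%:R :> R by rewrite ler_nat.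
rewrite -!natr1; nra.
Qed.

Hypothesis g_decr : forall l, g l.+1 < g l.

Lemma decr_le i j : (i <= j)%N -> g j <= g i.
Proof.
elim: j => [|j IH]; first by rewrite leqn0 => /eqP->.
rewrite leq_eqVlt => /predU1P[->//|]; rewrite ltnS => /IH.
exact/le_trans/ltW.
Qed.

Lemma decr_inj i j : g i = g j -> i = j.
Proof.
move=> e; case: (ltngtP i j) => // h; exfalso.
  by have := le_lt_trans (decr_le h) (g_decr i); rewrite e ltxx.
by have := le_lt_trans (decr_le h) (g_decr j); rewrite e ltxx.
Qed.

Lemma sum2_ge m m' l1 l2 : (m <= m' <= m.+1)%N -> (l1 + l2 <= m + m')%N ->
  g m + g m' <= g l1 + g l2.
Proof.
move=> mm' le_l; have h : (l1%:R + l2%:R <= m%:R + m'%:R :> R).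
  by rewrite -!natrD ler_nat.
have := tangent_le m l1; have := tangent_le m l2; have := g_decr m.
have [e|e] : m' = m \/ m' = m.+1 by lia.
  by rewrite e in h *; nra.
by rewrite e -natr1 in h *; nra.
Qed.

(** Add the supporting line at [m = minn s t] over the three lengths. It is exact at [s] and [t],
    both in {m, m+1}, and has negative slope, so a smaller total only helps. Equality forces the
    full total and all three lengths into {m, m+1}. *)
Lemma sum3_balanced s t l1 l2 l3 : (s <= t.+1)%N -> (t <= s.+1)%N ->
  (l1 + l2 + l3 <= 2 * s + t)%N ->
  2 * g s + g t <= g l1 + g l2 + g l3 /\
  (g l1 + g l2 + g l3 = 2 * g s + g t ->
   [\/ [/\ l1 = s, l2 = s & l3 = t], [/\ l1 = s, l2 = t & l3 = s]
     | [/\ l1 = t, l2 = s & l3 = s]]).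
Proof.
move=> st ts le_l; have h : (l1%:R + l2%:R + l3%:R <= 2 * s%:R + t%:R :> R).
  by rewrite -natrM -!natrD ler_nat.
pose m := minn s t; have d := g_decr m.
have gs : g s = g m - (g m - g m.+1) * (s%:R - m%:R).
  by have [->| ->] : s = m \/ s = m.+1 by [lia]; rewrite -?natr1; ring.
have gt : g t = g m - (g m - g m.+1) * (t%:R - m%:R).
  by have [->| ->] : t = m \/ t = m.+1 by [lia]; rewrite -?natr1; ring.
have T1 := tangent_le m l1; have T2 := tangent_le m l2; have T3 := tangent_le m l3.
split=> [|e]; first by rewrite gs gt; nra.
have sub l : g m - (g m - g m.+1) * (l%:R - m%:R) = g l -> l = m \/ l = m.+1.
  move=> el; case: (eqVneq l m) => [|lm]; first by left.
  case: (eqVneq l m.+1) => [|lm1]; first by right.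
  by have := tangent_lt lm lm1; rewrite el ltxx.
have E : l1%:R + l2%:R + l3%:R = 2 * s%:R + t%:R :> R.
  by rewrite gs gt in e; nra.
have {}E : (l1 + l2 + l3 = 2 * s + t)%N.
  by apply/eqP; rewrite -(eqr_nat R) natrD natrD natrD natrM E.
have l1E := sub l1; have l2E := sub l2; have l3E := sub l3.
have {}l1E : l1 = m \/ l1 = m.+1 by apply: l1E; rewrite gs gt in e; nra.
have {}l2E : l2 = m \/ l2 = m.+1 by apply: l2E; rewrite gs gt in e; nra.
have {}l3E : l3 = m \/ l3 = m.+1 by apply: l3E; rewrite gs gt in e; nra.
have st' : s = m \/ s = m.+1 by lia.
have tm' : t = m \/ t = m.+1 by lia.
clear -l1E l2E l3E E st' tm'.
have [e1|[e1|e1]] : (l1 = s /\ l2 = s /\ l3 = t) \/ (l1 = s /\ l2 = t /\ l3 = s) \/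
  (l1 = t /\ l2 = s /\ l3 = s) by lia.
- by apply: Or31; split; lia.
- by apply: Or32; split; lia.
- by apply: Or33; split; lia.
Qed.

End StrictlyConvexSequence.

(* With [q = exp (- theta)] this is
   [cosh ((l / 2 - 1) theta) / cosh (l theta / 2)]: the value next to an end of
   the solution of [x_(i-1) + x_(i+1) = (q + 1 / q) x_i] on a path of length
   [l] with value 1 at both ends. *)
Definition arm_end (R : realFieldType) (q : R) (l : nat) : R :=
  (q ^+ 2 + q ^+ l) / (q * (1 + q ^+ l)).

(** As [r] may vanish, the term that must be positive is the one in [t ^+ n]. *)
Lemma bernstein_gt0 (R : realFieldType) n (c : seq nat) (t r : R) :
  0 < t -> 0 <= r -> (0 < nth 0%N c n)%N ->
  0 < \sum_(k < n.+1) (nth 0%N c k)%:R * t ^+ k * r ^+ (n - k).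
Proof.
move=> t0 r0 c0; rewrite big_ord_recr /= ltr_wpDl//.
  by apply: sumr_ge0 => k _; rewrite !mulr_ge0 ?exprn_ge0 ?(ltW t0) ?ler0n.
by rewrite subnn expr0 mulr1 mulr_gt0 ?exprn_gt0 ?ltr0n.
Qed.

(** * Inequalities for [arm_end], including an arm of length 1 *)

Section ArmEnd.
Variables (R : realFieldType) (q : R).
Hypotheses (q_gt0 : 0 < q) (q_lt1 : q < 1).
Let g := arm_end q.

Lemma expq_bounds l : 0 < q ^+ l <= 1.
Proof. by rewrite exprn_gt0// exprn_ile1 ?ltW. Qed.

Lemma arm_endD l : g l - g l.+1 =
  (1 - q ^+ 2) * (1 - q) * q ^+ l / (q * (1 + q ^+ l) * (1 + q * q ^+ l)).
Proof.
have q0 := q_gt0; have q1 := q_lt1.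
rewrite /g /arm_end (exprS q l); have /andP[z0 z1] := expq_bounds l.
set z := q ^+ l in z0 z1 *; have qz := mulr_gt0 q_gt0 z0; field.
by rewrite !lt0r_neq0//; lra.
Qed.

Lemma arm_end_decr l : g l.+1 < g l.
Proof.
have q0 := q_gt0; have q1 := q_lt1.
rewrite -subr_gt0 arm_endD; have /andP[z0 z1] := expq_bounds l.
set z := q ^+ l in z0 z1 *; have qz := mulr_gt0 q_gt0 z0.
have q2 : q ^+ 2 < 1 by rewrite exprn_ilt1 ?ltW.
by rewrite divr_gt0// !mulr_gt0 ?subr_gt0//; lra.
Qed.

Lemma arm_end_convex l : g l.+1 - g l.+2 < g l - g l.+1.
Proof.
have q0 := q_gt0; have q1 := q_lt1.
rewrite !arm_endD (exprS q l); have /andP[z0 z1] := expq_bounds l.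
set z := q ^+ l in z0 z1 *.
have q2 : 0 < 1 - q * q by nra.
have p1 : 0 < 1 + z by lra.
have p2 : 0 < 1 + q * z by nra.
have p3 : 0 < 1 + q * (q * z) by nra.
rewrite -subr_gt0.
have -> : (1 - q ^+ 2) * (1 - q) * z / (q * (1 + z) * (1 + q * z)) -
  (1 - q ^+ 2) * (1 - q) * (q * z) / (q * (1 + q * z) * (1 + q * (q * z))) =
  (1 - q * q) * (1 - q) * z * ((1 - q) * (1 - q * z))
   / (q * (1 + z) * (1 + q * z) * (1 + q * (q * z))).
  by field; rewrite !lt0r_neq0.
have qz : 0 < 1 - q * z by nra.
have q1' : 0 < 1 - q by rewrite subr_gt0.
by rewrite divr_gt0// !mulr_gt0.
Qed.

(** Here [q] is the limit of [g l] for long arms. *)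
Lemma arm_end_gt l : q < g l.
Proof.
have q0 := q_gt0; have q1 := q_lt1.
have /andP[z0 z1] := expq_bounds l.
rewrite /g /arm_end; set z := q ^+ l in z0 z1 *.
rewrite ltr_pdivlMr; last by rewrite mulr_gt0//; lra.
have q2 : 0 < z * (1 - q * q) by rewrite mulr_gt0//; nra.
nra.
Qed.

(* [g l = q (1 + e l)] *)
Let e l := g l / q - 1.

Lemma arm_excessE l : e l = q ^+ l * (1 - q ^+ 2) / (q ^+ 2 * (1 + q ^+ l)).
Proof.
have q0 := q_gt0; have q1 := q_lt1.
have /andP[z0 z1] := expq_bounds l.
rewrite /e /g /arm_end; set z := q ^+ l in z0 z1 *.
by field; rewrite !lt0r_neq0//; lra.
Qed.

Lemma arm_excess_gt0 l : 0 < e l.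
Proof.
have q0 := q_gt0; have q1 := q_lt1.
rewrite arm_excessE; have /andP[z0 z1] := expq_bounds l.
have q2 : q ^+ 2 < 1 by rewrite exprn_ilt1 ?ltW.
by rewrite divr_gt0// !mulr_gt0 ?exprn_gt0 ?subr_gt0//; lra.
Qed.

Lemma arm_excess_decr l : e l.+1 < e l.
Proof. by rewrite /e ltrD2r ltr_pM2r ?invr_gt0// arm_end_decr. Qed.

(** Up to a constant factor [e l] is z / (1 + z) with z = q^l, which decays more slowly than z. This
    bounds [e 4] and [e 5] from below by [e 3]. *)
Lemma arm_excess_ratio l : q * e l <= e l.+1.
Proof.
have q0 := q_gt0; have q1 := q_lt1.
rewrite !arm_excessE (exprS q l); have /andP[z0 z1] := expq_bounds l.
set z := q ^+ l in z0 z1 *.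
have p1 : 0 < 1 + z by lra.
have p2 : 0 < 1 + q * z by nra.
rewrite -subr_ge0.
have -> : q * z * (1 - q ^+ 2) / (q ^+ 2 * (1 + q * z)) -
  q * (z * (1 - q ^+ 2) / (q ^+ 2 * (1 + z))) =
  z * (1 - q * q) * (z * (1 - q)) / (q * (1 + q * z) * (1 + z)).
  by field; rewrite !lt0r_neq0.
have q1' : 0 < 1 - q by rewrite subr_gt0.
by rewrite ltW// divr_gt0// !mulr_gt0//; nra.
Qed.

Lemma arm_excess3E : e 3 = q * (1 - q) / (1 - q + q ^+ 2).
Proof.
have q0 := q_gt0; have q1 := q_lt1.
rewrite arm_excessE; field.
have : 0 < 1 - q + q ^+ 2 by nra.
have : 0 < 1 + q ^+ 3 by rewrite ltr_wpDr// exprn_ge0// ltW.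
by move=> h1 h2; rewrite !lt0r_neq0.
Qed.

Lemma arm_excess4E : e 4 = q ^+ 2 * (1 - q ^+ 2) / (1 + q ^+ 4).
Proof.
rewrite arm_excessE; field.
have : 0 < 1 + q ^+ 4 by rewrite ltr_wpDr// exprn_ge0// ltW.
by move=> h1; rewrite !lt0r_neq0.
Qed.

(** With denominators cleared this is (2 q - 1)^2 >= 0. It is tight at q = 1/2, so strictness
    against an eight has to come from [arm_end_gt]. *)
Lemma three_arm_end3_le : 3 * g 3 <= 4 * q.
Proof.
have q0 := q_gt0; have q1 := q_lt1.
suff : 3 * e 3 <= 1.
  rewrite /e mulrBr mulr1 lerBlDr mulrA ler_pdivrMr//; lra.
have := sqr_ge0 (2 * q - 1).
by rewrite arm_excess3E mulrA ler_pdivrMr; nra.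
Qed.

(** Left minus right side grows from [E] to [F] by (F - E) ((1 + E + F) + (2 + E + F) q^2). This
    allows replacing [E] by an explicit upper bound. *)
Lemma quadratic_mono (E F : R) : 0 <= 1 + E -> 0 <= F -> E <= F ->
  (1 + F) ^+ 2 * (1 + q ^+ 2) < 3 + F ->
  (1 + E) ^+ 2 * (1 + q ^+ 2) < 3 + E.
Proof.
move=> E0 F0 EF hF; have h : 0 <= (F - E) * (1 + E + F) by rewrite mulr_ge0; lra.
have h2 : 0 <= (F - E) * (1 + E + (1 + F)) * q ^+ 2.
  by rewrite mulr_ge0 ?exprn_ge0 ?(ltW q_gt0)// mulr_ge0; lra.
nra.
Qed.

Lemma quadratic_lt (E F : R) : 0 <= 1 + E -> 0 <= F -> E < F ->
  (1 + F) ^+ 2 * (1 + q ^+ 2) <= 3 + F ->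
  (1 + E) ^+ 2 * (1 + q ^+ 2) < 3 + E.
Proof.
move=> E0 F0 EF hF.
have h : 0 <= (F - E) * (1 + E + F) by rewrite mulr_ge0; lra.
have h2 : 0 < (F - E) * (1 + E + (1 + F)) * q ^+ 2.
  by rewrite mulr_gt0 ?exprn_gt0// mulr_gt0; lra.
nra.
Qed.

(* Bernstein expansions on [0, 1/2] and [1/2, 1]. *)
Lemma short_arm_octic :
  (1 + 2 * q - 4 * q ^+ 2 + 2 * q ^+ 3) ^+ 2 * (1 + q ^+ 2) <
  (1 - q + q ^+ 2) * (3 - 2 * q ^+ 2 + 2 * q ^+ 3).
Proof.
(* The factor 64 makes the degree 8 Bernstein coefficients natural numbers on both halves; the value
   at q = 1/2 is 7/64. *)
rewrite -subr_gt0 -(@pmulr_rgt0 _ 64) ?ltr0n//.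
case: (lerP (2 * q) 1) => h.
  have h0 : 0 < 2 * q by rewrite mulr_gt0.
  have h1 : 0 <= 1 - 2 * q by rewrite subr_ge0.
  have := @bernstein_gt0 _ 8 [:: 128; 800; 2080; 2944; 2464; 1244; 376; 68;
    7] _ _ h0 h1 isT.
  rewrite !big_ord_recr big_ord0 /= => /lt_le_trans; apply.
  rewrite le_eqVlt; apply/orP; left; apply/eqP; ring.
have h0 : 0 < 2 * q - 1 by rewrite subr_gt0.
have h1 : 0 <= 2 * (1 - q) by rewrite mulr_ge0// subr_ge0 ltW.
have := @bernstein_gt0 _ 8 [:: 7; 44; 208; 692; 1384; 1632; 1120; 416; 64] _ _ h0 h1 isT.
rewrite !big_ord_recr big_ord0 /= => /lt_le_trans; apply.
  rewrite le_eqVlt; apply/orP; left; apply/eqP; ring.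
Qed.

Lemma arm_excess_le i j : (i <= j)%N -> e j <= e i.
Proof. exact: (decr_le arm_excess_decr). Qed.

(** This is what [short_arm] becomes without a and b. In terms of [e] its claim is b q (1 + E) < a
    with E = 2 e(s) + e(t) - e(l1) - e(l2); squaring and inserting the equation for q removes the
    ratio a / b. The bound on [q ^+ 2] is the trace of a <= b. *)
Lemma short_arm_excess (s t l1 l2 : nat) :
  (s <= t.+1)%N -> (t <= s.+1)%N -> (8 < 2 * s + t)%N ->
  (l1 + l2 < 2 * s + t)%N -> q ^+ 2 * (3 + (2 * e s + e t)) <= 1 + q ^+ 2 ->
  0 <= 1 + (2 * e s + e t - e l1 - e l2) ->
  (1 + (2 * e s + e t - e l1 - e l2)) ^+ 2 * (1 + q ^+ 2) < 3 + (2 * e s + e t).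
Proof.
move=> st ts n8 le_l le_p E0; have q0 := q_gt0; have q1 := q_lt1.
have El : 2 * e s + e t - e l1 - e l2 < 2 * e s + e t.
  by have := arm_excess_gt0 l1; have := arm_excess_gt0 l2; lra.
have es := arm_excess_gt0 s; have et := arm_excess_gt0 t.
set S := 2 * e s + e t in le_p E0 El *; set E := S - _ - _ in E0 El *.
have S0 : 0 < S by rewrite /S; lra.
have pair m m' : (m <= m' <= m.+1)%N -> (l1 + l2 <= m + m')%N ->
    e m + e m' <= e l1 + e l2.
  move=> h1 h2; have := sum2_ge arm_end_convex arm_end_decr h1 h2.
  by rewrite -(ler_pM2r (x := q^-1)) ?invr_gt0// /e !mulrDl; lra.
case: (leqP (2 * s + t) 11) => [n11|n11]; last first.
  (* With p = q ^ 2 there are two upper bounds for S, 1 / p - 2 from le_p and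
     3 * e 4; the first is good enough exactly when p ^ 2 - 3 p + 1 <= 0, the
     second one otherwise. *)
  have s4 : (4 <= s)%N by clear -st ts n11; lia.
  have t4 : (4 <= t)%N by clear -st ts n11; lia.
  have S4 : S <= 3 * e 4 by rewrite /S; have := arm_excess_le s4; have :=
    arm_excess_le t4; lra.
  suff : (1 + E) ^+ 2 * (1 + q ^+ 2) < 3 + E by lra.
  rewrite arm_excess4E in S4; set p := q ^+ 2 in le_p S4 *.
  have p0 : 0 < p by rewrite exprn_gt0.
  have p1 : p < 1 by rewrite exprn_ilt1 ?ltW.
  have pE : q ^+ 4 = p ^+ 2 by rewrite -exprM.
  rewrite pE in S4.
  case: (lerP (p ^+ 2 - 3 * p + 1) 0) => hp.
    have SF : S <= p^-1 - 2.
      rewrite -(ler_pM2l p0) mulrBr divff ?lt0r_neq0//; lra.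
    apply: (@quadratic_lt _ (p^-1 - 2)) => //; [lra|lra|].
    rewrite -/p -subr_ge0.
    have -> : 3 + (p^-1 - 2) - (1 + (p^-1 - 2)) ^+ 2 * (1 + p) =
       (1 + p) * (- (p ^+ 2 - 3 * p + 1)) / p ^+ 2 by field; rewrite lt0r_neq0.
    by rewrite divr_ge0 ?mulr_ge0 ?exprn_ge0//; lra.
  set F := 3 * _ in S4.
  apply: (@quadratic_lt _ F) => //; [lra|lra|].
  rewrite -/p -subr_ge0 /F.
  have p2 : 0 < 1 + p ^+ 2 by rewrite ltr_wpDr ?exprn_ge0 ?ltW.
  have -> : 3 + 3 * (p * (1 - p) / (1 + p ^+ 2)) -
     (1 + 3 * (p * (1 - p) / (1 + p ^+ 2))) ^+ 2 * (1 + p) =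
     2 * (1 + p) * ((p ^+ 2 - 3 * p + 1) * (1 - 2 * p ^+ 2)) / (1 + p ^+ 2) ^+ 2.
    by field; rewrite lt0r_neq0.
  rewrite divr_ge0 ?exprn_ge0 ?(ltW p2)// !mulr_ge0 ?(ltW hp)//; nra.
(* A common bound for the totals 9, 10 and 11. Replacing [l1], [l2] by the balanced pairs (4,4),
   (4,5), (5,5) gives 3 e(3) - 2 e(4), 2 e(3) - e(5) and e(3) + 2 e(4) - 2 e(5), each at most [F] by
   [arm_excess_ratio] and monotonicity. *)
pose F := (3 - 2 * q) * e 3.
have EF : E <= F.
  have := arm_excess_ratio 3; have := arm_excess_ratio 4; have := arm_excess_decr 3;
    have := arm_excess_decr 4.
  have := arm_excess_gt0 3; have := arm_excess_gt0 4; have := arm_excess_gt0 5.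
  set x3 := e 3; set x4 := e 4; set x5 := e 5 => h5 h4 h3 d4 d3 r4 r3.
  have [n|[n|n]] : (2 * s + t = 9 \/ 2 * s + t = 10 \/ 2 * s + t = 11)%N
    by clear -n8 n11; lia.
  - have [s3 t3] : s = 3 /\ t = 3 by clear -n st ts; lia.
    rewrite n in le_l; have := pair 4 4 isT le_l; rewrite /E /S s3 t3 -/x3 -/x4 /F -/x3.
    lra.
  - have [s3 t3] : s = 3 /\ t = 4 by clear -n st ts; lia.
    rewrite n in le_l; have := pair 4 5 isT le_l;
      rewrite /E /S s3 t3 -/x3 -/x4 -/x5 /F -/x3.
    nra.
  - have [s3 t3] : s = 4 /\ t = 3 by clear -n st ts; lia.
    rewrite n in le_l; have := pair 5 5 isT le_l;
      rewrite /E /S s3 t3 -/x3 -/x4 -/x5 /F -/x3.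
    nra.
suff : (1 + E) ^+ 2 * (1 + q ^+ 2) < 3 + E by lra.
have F0 : 0 < F by rewrite mulr_gt0 ?arm_excess_gt0//; lra.
apply: (@quadratic_mono _ F) => //; first exact: ltW.
have v0 : 0 < 1 - q + q ^+ 2 by nra.
rewrite /F arm_excess3E -subr_gt0.
have -> : 3 + (3 - 2 * q) * (q * (1 - q) / (1 - q + q ^+ 2)) -
  (1 + (3 - 2 * q) * (q * (1 - q) / (1 - q + q ^+ 2))) ^+ 2 * (1 + q ^+ 2) =
  ((1 - q + q ^+ 2) * (3 - 2 * q ^+ 2 + 2 * q ^+ 3) -
  (1 + 2 * q - 4 * q ^+ 2 + 2 * q ^+ 3) ^+ 2 * (1 + q ^+ 2)) /
   (1 - q + q ^+ 2) ^+ 2 by field; rewrite lt0r_neq0.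
by rewrite divr_gt0 ?exprn_gt0// subr_gt0 short_arm_octic.
Qed.

(** The third arm is an edge: it uses length 1, hence the strict bound on [l1 + l2], and contributes
    only [b], whereas [b ^+ 2 / a * g 1] is [b ^+ 2 / a >= b]; so [sum3_balanced] does not apply. *)
Lemma short_arm (a b : R) (s t l1 l2 : nat) : 0 < a -> a <= b ->
  a ^+ 2 * (1 + q ^+ 2) = b ^+ 2 * (q * (2 * g s + g t)) ->
  (s <= t.+1)%N -> (t <= s.+1)%N -> (8 < 2 * s + t)%N ->
  (l1 + l2 < 2 * s + t)%N ->
  b ^+ 2 / a * (2 * g s + g t) < b + b ^+ 2 / a * (g l1 + g l2).
Proof.
move=> a0 ab eq_ab st ts n8 le_l; have q0 := q_gt0; have q1 := q_lt1.
have b0 : 0 < b by lra.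
have gE l : g l = q * (1 + e l).
  by rewrite /e addrC subrK mulrCA divff ?mulr1 ?lt0r_neq0.
have {}eq_ab : a ^+ 2 * (1 + q ^+ 2) = b ^+ 2 * (q ^+ 2 * (3 + (2 * e s + e t))).
  by rewrite eq_ab !gE; ring.
have le_p : q ^+ 2 * (3 + (2 * e s + e t)) <= 1 + q ^+ 2.
  rewrite -(@ler_pM2l _ (b ^+ 2)) ?exprn_gt0// -eq_ab ler_wpM2r//.
    by rewrite addr_ge0 ?exprn_ge0 ?ltW.
  by rewrite ler_sqr ?nnegrE ?(ltW a0) ?(ltW b0).
set E := 2 * e s + e t - e l1 - e l2.
(* Equivalent to the goal. Squaring requires [0 <= 1 + E]; otherwise the left side is negative. *)
have : b * (q * (1 + E)) < a.
  case: (lerP 0 (1 + E)) => E0; last first.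
    apply: lt_trans a0; rewrite pmulr_rlt0// pmulr_rlt0//.
  have := short_arm_excess st ts n8 le_l le_p E0; rewrite -/E => h.
  have q2 : 0 < 1 + q ^+ 2 by rewrite ltr_wpDr ?exprn_ge0 ?ltW.
  rewrite -(@ltr_pXn2r _ 2) ?nnegrE ?mulr_ge0 ?(ltW a0) ?(ltW b0) ?(ltW q0)//.
  rewrite -(ltr_pM2r q2) eq_ab.
  have -> : (b * (q * (1 + E))) ^+ 2 * (1 + q ^+ 2) =
    b ^+ 2 * (q ^+ 2 * ((1 + E) ^+ 2 * (1 + q ^+ 2))) by ring.
  by rewrite !ltr_pM2l ?exprn_gt0.
move=> h; rewrite -(ltr_pM2l a0) !mulrDr.
have -> : a * (b ^+ 2 / a * (2 * g s)) + a * (b ^+ 2 / a * g t) = b ^+ 2 * (2 * g s +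
  g t).
  by field; rewrite lt0r_neq0.
have -> : a * b + (a * (b ^+ 2 / a * g l1) + a * (b ^+ 2 / a * g l2)) = a * b + b ^+
  2 * (g l1 + g l2).
  by field; rewrite lt0r_neq0.
have {}h : b * (q * (1 + E)) * b < a * b by rewrite ltr_pM2r.
rewrite !gE; move: h; rewrite /E.
by move: (e s) (e t) (e l1) (e l2) => x y z w h; lra.
Qed.
End ArmEnd.

(** * The test vector *)

(** With denominators cleared the equation is P(q) = 0, where P(0) = - a^2 and P(1) = 12 b^2 - 8 a^2
    > 0, so a root lies strictly between. *)
Lemma exists_decay (R : rcfType) (a b : R) (s t : nat) : 0 < a -> a <= b ->
  (0 < s)%N -> (0 < t)%N ->
  exists2 q, 0 < q < 1 &
    a ^+ 2 * (1 + q ^+ 2) = b ^+ 2 * (q * (2 * arm_end q s + arm_end q t)).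
Proof.
move=> a0 ab s0 t0.
pose P : {poly R} := (b ^+ 2)%:P * (2%:P * ('X^2 + 'X^s) * (1 + 'X^t) +
   ('X^2 + 'X^t) * (1 + 'X^s)) - (a ^+ 2)%:P * (1 + 'X^2) * (1 + 'X^s) * (1 + 'X^t).
have PE x : P.[x] = b ^+ 2 * (2 * (x ^+ 2 + x ^+ s) * (1 + x ^+ t) +
   (x ^+ 2 + x ^+ t) * (1 + x ^+ s)) - a ^+ 2 * (1 + x ^+ 2) * (1 + x ^+ s) * (1 + x
     ^+ t).
  by rewrite /P !hornerE.
have P0 : P.[0] < 0.
  by rewrite PE !expr0n !gtn_eqF//= !(addr0, mulr0, mul0r, mulr1) sub0r oppr_lt0
    exprn_gt0.
have P1 : 0 < P.[1] by rewrite PE !expr1n; nra.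
have [|q /andP[q0 q1] /rootP Pq] := @poly_ivt _ P 0 1 ler01; first by rewrite !ltW.
have {}q0 : 0 < q.
  by rewrite lt_def q0 andbT; apply: contraTneq P0 => e; rewrite e in Pq; rewrite Pq ltxx.
have {}q1 : q < 1.
  by rewrite lt_def q1 andbT; apply: contraTneq P1 => e; rewrite -e in Pq;
    rewrite Pq ltxx.
exists q; first by rewrite q0.
have s1 : 0 < 1 + q ^+ s by rewrite ltr_wpDr ?exprn_ge0 ?(ltW q0).
have t1 : 0 < 1 + q ^+ t by rewrite ltr_wpDr ?exprn_ge0 ?(ltW q0).
apply/eqP; rewrite -subr_eq0 /arm_end.
have -> : a ^+ 2 * (1 + q ^+ 2) - b ^+ 2 * (q * (2 * ((q ^+ 2 + q ^+ s) /
   (q * (1 + q ^+ s))) + (q ^+ 2 + q ^+ t) / (q * (1 + q ^+ t)))) =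
   - P.[q] / ((1 + q ^+ s) * (1 + q ^+ t)).
  by rewrite PE; field; rewrite !lt0r_neq0.
by rewrite Pq oppr0 mul0r.
Qed.

Section TestVector.
Variables (R : realType) (f : R -> R -> R).
Hypothesis f_gt0 : forall x y : R, 0 < x -> 0 < y -> 0 < f x y.
Hypothesis f_sym : forall x y : R, 0 < x -> 0 < y -> f x y = f y x.
Hypothesis f_incr : forall x1 x2 y : R,
  0 < x1 -> x1 <= x2 -> 0 < y -> f x1 y <= f x2 y.
Local Notation a := (f 2 2).
Local Notation b := (f 2 3).
Variable q : R.
Hypotheses (q_gt0 : 0 < q) (q_lt1 : q < 1).
Let lam := a * (q + q^-1).

Lemma f_le (d1 d2 e1 e2 : nat) : (0 < d1 <= e1)%N -> (0 < d2 <= e2)%N ->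
  f d1%:R d2%:R <= f e1%:R e2%:R.
Proof.
case/andP=> d1_gt0 le1 /andP[d2_gt0 le2].
have e1_gt0 := leq_trans d1_gt0 le1; have e2_gt0 := leq_trans d2_gt0 le2.
apply: (@le_trans _ _ (f e1%:R d2%:R)); first by rewrite f_incr ?ltr0n ?ler_nat.
by rewrite f_sym ?ltr0n// [leRHS]f_sym ?ltr0n// f_incr ?ltr0n ?ler_nat.
Qed.

Lemma a_gt0 : 0 < a. Proof. by rewrite f_gt0 ?ltr0n. Qed.
Lemma b_gt0 : 0 < b. Proof. by rewrite f_gt0 ?ltr0n. Qed.
Lemma le_ab : a <= b. Proof. exact: (@f_le 2 2 2 3). Qed.
Lemma f32 : f 3 2 = b. Proof. by rewrite f_sym ?ltr0n. Qed.
Lemma le_b_f33 : b <= f 3 3. Proof. exact: (@f_le 2 3 3 3). Qed.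

(* Not normalised at [i = 0]: [a * profile l 0 = b], so that an end of the arm
   with value 1 and edge weight [b] acts like a vertex of value [profile l 0]
   and edge weight [a]. *)
Definition profile (l i : nat) : R :=
  b / a * (q ^+ i + q ^+ (l - i)) / (1 + q ^+ l).

Lemma denom_gt0 l : 0 < 1 + q ^+ l.
Proof. by rewrite ltr_wpDr ?exprn_ge0// ltW. Qed.

Lemma profile_gt0 l i : 0 < profile l i.
Proof.
by rewrite divr_gt0 ?denom_gt0// mulr_gt0 ?divr_gt0 ?b_gt0 ?a_gt0// addr_gt0 ?exprn_gt0.
Qed.

Lemma profile_rev l i : (i <= l)%N -> profile l (l - i) = profile l i.
Proof. by move=> il; rewrite /profile subKn// addrC. Qed.

Lemma a_profile0 l : a * profile l 0 = b.
Proof.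
rewrite /profile subn0 expr0; field.
by rewrite !lt0r_neq0 ?a_gt0 ?denom_gt0.
Qed.

Lemma profile_rec l i : (i.+2 <= l)%N ->
  a * profile l i + a * profile l i.+2 = lam * profile l i.+1.
Proof.
move=> il; rewrite /profile /lam.
have -> : (l - i = (l - i.+2).+2)%N by lia.
have -> : (l - i.+1 = (l - i.+2).+1)%N by lia.
rewrite !(exprS q _.+1) !(exprS q i) !(exprS q (l - i.+2)).
set A := q ^+ i; set B := q ^+ (l - i.+2); set C := q ^+ l.
have C0 : 1 + C != 0 by rewrite lt0r_neq0// denom_gt0.
field.
by rewrite C0 !lt0r_neq0 ?a_gt0.
Qed.

Lemma b_profile1 l : (0 < l)%N -> b * profile l 1 = b ^+ 2 / a * arm_end q l.
Proof.
case: l => // l _; rewrite /profile /arm_end subSS subn0 expr1.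
have := denom_gt0 l.+1; rewrite !(exprS q l) => h; field.
by rewrite !lt0r_neq0 ?a_gt0.
Qed.

Section Arms.
Variable G : sgraph.
Implicit Types (u v w : G) (p : seq G) (x : G -> R).

(* The degrees that [theta_graph] and [infinity_graph] realise; in a graph that
   merely contains one of them as a subgraph they are lower bounds. *)
Definition ideal_deg (B : pred G) w : nat := (if B w then 3 else 2)%N.

Definition ideal_sum (B : pred G) x w (s : seq G) : R :=
  \sum_(z <- s) f (ideal_deg B w)%:R (ideal_deg B z)%:R * x z.

Lemma ideal_sum_le (B : pred G) x w (s : seq G) :
  (forall z, 0 <= x z) -> uniq s -> all (adj w) s ->
  {in w :: s, forall z, ideal_deg B z <= degree z}%N ->
  ideal_sum B x w s <= fadj_apply f x w.
Proof.
move=> x0 us /allP ws dle; apply: le_trans (le_fadj_apply f_gt0 x0 us ws).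
rewrite /ideal_sum big_seq [leRHS]big_seq; apply: ler_sum => z zs;
  rewrite ler_wpM2r// f_le//.
  by rewrite dle ?mem_head// andbT /ideal_deg; case: ifP.
by rewrite dle ?inE ?zs ?orbT// andbT /ideal_deg; case: ifP.
Qed.

Lemma ideal_sum_eq (B : pred G) x w (s : seq G) :
  uniq s -> all (adj w) s -> size s = degree w ->
  {in w :: s, forall z, ideal_deg B z = degree z} ->
  fadj_apply f x w = ideal_sum B x w s.
Proof.
move=> us /allP ws sz deq.
have nE : neighbors w =i s.
  apply/fsym/subset_cardP.
    by rewrite -[RHS]sz; apply/card_uniqP.
  by apply/subsetP => z /ws; rewrite inE.
rewrite /fadj_apply /ideal_sum big_uniq//=.
apply: eq_big => [z|z wz]; first by rewrite -nE inE.
by rewrite !deq ?mem_head// inE -nE inE wz orbT.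
Qed.

(** The ends may coincide, the arm then being a cycle; the last clause keeps its first and last
    inner vertices distinct. *)
Definition is_arm u v p : bool :=
  [&& path (@adj G) u (rcons p v), uniq p, u \notin p, v \notin p
    & (u != v) || (1 < size p)%N].

(** [p] lists inner vertices only: its length as an arm is one more than its size, and positions
    start at 1. *)
Definition arm_value p w : R := profile (size p).+1 (index w p).+1.

(** The witness consists of the predecessor and the successor of [w]. Returned with its
    distinctness, it serves the degree bound, the Rayleigh bound and the exact eigenvector
    equation. *)
Lemma arm_interior (B : pred G) u v p x w : is_arm u v p ->
  B u -> B v -> {in p, forall z, ~~ B z} -> x u = 1 -> x v = 1 ->
  {in p, forall z, x z = arm_value p z} -> w \in p ->
  exists s, [/\ uniq s, all (adj w) s, size s = 2%N, {subset s <= u :: v :: p}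
    & ideal_sum B x w s = lam * x w].
Proof.
move=> /and5P[pp pu up vp uvp] Bu Bv Bp xu xv xp wp.
have Dw : ideal_deg B w = 2 by rewrite /ideal_deg (negPf (Bp _ wp)).
case/splitPr: p / wp pp pu up vp uvp Bp xp => p1 p2 pp pu up vp uvp Bp xp.
set p := p1 ++ w :: p2 in pp pu up vp uvp Bp xp.
pose l := (size p).+1; have lE : l = (size p1 + size p2).+2.
  by rewrite /l /p size_cat /= addnS.
have xw : x w = profile l (size p1).+1.
  by rewrite xp /arm_value ?index_cat_cons// mem_cat mem_head orbT.
have T1 : f 2 (ideal_deg B (last u p1))%:R * x (last u p1) = a * profile l (size p1).
  case/lastP: p1 @p @l lE xp Bp pu up vp uvp {pp xw} => [|p1 z] p l lE xp Bp pu up vp uvp.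
    by rewrite /= xu /ideal_deg Bu a_profile0 mulr1.
  have zp : z \in p by rewrite /p mem_cat mem_rcons mem_head.
  rewrite last_rcons xp// /ideal_deg (negPf (Bp _ zp)) /arm_value.
  by rewrite [p]cat_rcons index_cat_cons ?size_rcons// -cat_rcons.
have T2 : f 2 (ideal_deg B (head v p2))%:R * x (head v p2) = a * profile l (size p1).+2.
  case: p2 @p @l lE xp Bp pu up vp uvp {pp xw T1} => [|z p2] p l lE xp Bp pu up vp uvp.
    rewrite /= xv /ideal_deg Bv mulr1 -(a_profile0 l) -[in RHS]profile_rev lE ?addn0//.
    by rewrite subnn.
  have zp : z \in p by rewrite /p mem_cat !inE eqxx !orbT.
  rewrite /= xp// /ideal_deg (negPf (Bp _ zp)) /arm_value.
  by rewrite /p -cat_rcons index_cat_cons ?size_rcons// cat_rcons.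
move: pp; rewrite rcons_cat cat_path => /andP[pp1 /andP[z1w pp2]].
have wz2 : adj w (head v p2) by move: pp2; case: (p2) => [|z p2'] /= /andP[].
exists [:: last u p1; head v p2]; split => //=.
(* Equal neighbours of [w] would have to be [u = v] with [w] the only inner vertex, which [is_arm]
   excludes. *)
- rewrite andbT inE; apply/eqP => e.
  have z1 : last u p1 \in u :: p1 by apply: mem_last.
  have z2 : head v p2 \in rcons p2 v.
    by case: (p2) => [|z p2']; rewrite /= mem_head.
  move: pu up vp uvp; rewrite /p cat_uniq !mem_cat !inE !negb_or size_cat /= addnS.
  case/and3P=> _ /andP[_ h] _ /and3P[up1 _ up2] /and3P[vp1 _ _].
  move: z1 z2; rewrite -e mem_rcons !inE => /orP[/eqP eu|z1].
    rewrite eu => /orP[/eqP uv|]; last by rewrite (negPf up2).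
    have p1E : p1 = [::] by case/lastP: (p1) eu up1 => // s z;
      rewrite last_rcons mem_rcons inE => ->; rewrite eqxx.
    rewrite uv eqxx p1E /= add0n; case: (p2) e eu up2 => //= z s -> ->.
    by rewrite mem_head.
  case/orP => [/eqP ev|z2]; first by rewrite -ev z1 in vp1.
  by case/hasP: h; exists (last u p1).
- by rewrite adj_sym z1w wz2.
- move=> z; rewrite !inE => /orP[/eqP->|/eqP->].
    have := mem_last u p1; rewrite inE mem_cat => /orP[->//|->].
    by rewrite !orbT.
  case: (p2) => [|z' s] /=; rewrite ?eqxx ?orbT// mem_cat !inE eqxx.
  by rewrite !orbT.
rewrite /ideal_sum Dw !big_cons big_nil addr0 T1 T2 xw profile_rec//.
by rewrite lE !ltnS leq_addr.
Qed.

Lemma arm_head (B : pred G) u v p x : is_arm u v p -> p != [::] ->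
  B u -> {in p, forall z, ~~ B z} ->
  {in p, forall z, x z = arm_value p z} ->
  [/\ adj u (head v p), head v p \in p &
  ideal_sum B x u [:: head v p] = b ^+ 2 / a * arm_end q (size p).+1].
Proof.
case: p => // z p /and5P[/andP[/= uz _] _ _ _ _] _ Bu Bp xp.
split; rewrite ?mem_head// /ideal_sum big_seq1 /ideal_deg Bu.
by rewrite (negPf (Bp z _)) ?mem_head//= xp ?mem_head// /arm_value /= eqxx f32 b_profile1.
Qed.

Lemma arm_last (B : pred G) u v p x : is_arm u v p -> p != [::] ->
  B v -> {in p, forall z, ~~ B z} ->
  {in p, forall z, x z = arm_value p z} ->
  [/\ adj v (last u p), last u p \in p &
  ideal_sum B x v [:: last u p] = b ^+ 2 / a * arm_end q (size p).+1].
Proof.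
case/lastP: p => // p z /and5P[pp pu _ _ _] _ Bu Bp xp.
have zp : z \in rcons p z by rewrite mem_rcons mem_head.
move: pp; rewrite last_rcons rcons_path last_rcons => /andP[_ zv].
split; rewrite ?(adj_sym v)// /ideal_sum big_seq1 /ideal_deg Bu.
rewrite (negPf (Bp z _))//= xp// /arm_value -cats1 index_cat_cons ?cats1//.
by rewrite size_rcons f32 -b_profile1// -[in LHS]profile_rev// subSS subSn// subnn.
Qed.

Lemma short_arm_end (B : pred G) u v x : B u -> B v -> x v = 1 ->
  b <= ideal_sum B x u [:: v].
Proof.
by move=> Bu Bv xv; rewrite /ideal_sum big_seq1 /ideal_deg Bu Bv xv mulr1 le_b_f33.
Qed.

End Arms.

Lemma degree_ge (G : sgraph) (w : G) (s : seq G) :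
  uniq s -> all (adj w) s -> (size s <= degree w)%N.
Proof.
move=> us /allP ws; rewrite -(card_uniqP us); apply: subset_leq_card.
by apply/subsetP => z /ws; rewrite inE.
Qed.

Lemma ideal_sum_cat (G : sgraph) B x (w : G) s1 s2 :
  ideal_sum B x w (s1 ++ s2) = ideal_sum B x w s1 + ideal_sum B x w s2.
Proof. by rewrite /ideal_sum big_cat. Qed.

(* What an arm contributes at one of its ends; for an arm that is a single edge
   the actual weight [f 3 3] is only bounded from below. *)
Definition arm_weight (G : sgraph) (p : seq G) : R :=
  if p is [::] then b else b ^+ 2 / a * arm_end q (size p).+1.

(** * The test vector on a structure with three arms *)

Section Structure.
Variables (G : sgraph) (u v : G) (p1 p2 p3 : seq G).

(** One vector for all three structures: the ends of the arms are left to [c1], ..., [d3] below, and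
    an eight is the case [u = v] with [p3] empty. *)
Definition test_vec (w : G) : R :=
  if w \in [:: u; v] then 1
  else if w \in p1 then arm_value p1 w
  else if w \in p2 then arm_value p2 w
  else if w \in p3 then arm_value p3 w else 0.

Local Notation x := test_vec.
Local Notation B := (pred2 u v).

Hypothesis p_uniq : uniq (p1 ++ p2 ++ p3).
Hypothesis u_notin : u \notin p1 ++ p2 ++ p3.
Hypothesis v_notin : v \notin p1 ++ p2 ++ p3.

Lemma test_vec_ge0 w : 0 <= x w.
Proof.
by rewrite /test_vec /arm_value; do 4?[case: ifP => // _]; rewrite ltW// profile_gt0.
Qed.

Lemma test_vec_u : x u = 1. Proof. by rewrite /test_vec mem_head. Qed.
Lemma test_vec_v : x v = 1. Proof. by rewrite /test_vec !inE eqxx orbT. Qed.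

Lemma pred2_notin w : w \in p1 ++ p2 ++ p3 -> ~~ B w.
Proof.
by move=> wp; apply/negP => /orP[/eqP e|/eqP e]; move: u_notin v_notin; rewrite -e wp.
Qed.

Lemma test_vec_p1 : {in p1, forall w, x w = arm_value p1 w}.
Proof.
move=> w wp; have /pred2_notin : w \in p1 ++ p2 ++ p3 by rewrite mem_cat wp.
by rewrite /test_vec !inE /= => /negPf ->; rewrite wp.
Qed.

Lemma test_vec_p2 : {in p2, forall w, x w = arm_value p2 w}.
Proof.
move=> w wp; have /pred2_notin : w \in p1 ++ p2 ++ p3 by rewrite !mem_cat wp orbT.
rewrite /test_vec !inE /= => /negPf ->; case: ifP => [wp1|]; last by rewrite wp.
move: p_uniq; rewrite cat_uniq => /and3P[_ /hasPn/(_ w)].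
by rewrite mem_cat wp /= wp1 => /(_ isT).
Qed.

Lemma test_vec_p3 : {in p3, forall w, x w = arm_value p3 w}.
Proof.
move=> w wp; have /pred2_notin : w \in p1 ++ p2 ++ p3 by rewrite !mem_cat wp !orbT.
rewrite /test_vec !inE /= => /negPf ->; case: ifP => [wp1|_].
  move: p_uniq; rewrite cat_uniq => /and3P[_ /hasPn/(_ w)].
  by rewrite mem_cat wp orbT /= wp1 => /(_ isT).
case: ifP => [wp2|]; last by rewrite wp.
move: p_uniq; rewrite !cat_uniq => /and5P[_ _ _ /hasPn/(_ w)].
by rewrite wp /= wp2 => /(_ isT).
Qed.

Lemma test_vec_out w : ~~ B w -> w \notin p1 ++ p2 ++ p3 -> x w = 0.
Proof.
by rewrite !mem_cat /test_vec !inE /= => /negPf->;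
  case/norP => /negPf-> /norP[/negPf-> /negPf->].
Qed.

Lemma test_vec_gt0 w : w \in u :: v :: p1 ++ p2 ++ p3 -> 0 < x w.
Proof.
rewrite 2!inE orbA => /orP[|]; first by rewrite /test_vec !inE => ->.
rewrite !mem_cat => /or3P[/[dup] /test_vec_p1->|/[dup] /test_vec_p2->|/[dup]
  /test_vec_p3->] _; exact: profile_gt0.
Qed.

Variables (c1 d1 c2 d2 c3 d3 : G).
Hypotheses (arm1 : is_arm c1 d1 p1) (arm2 : is_arm c2 d2 p2).
Hypothesis arm3 : (p3 != [::]) ==> is_arm c3 d3 p3.
Hypothesis ends : all B [:: c1; d1; c2; d2; c3; d3].

Lemma test_vec_B w : B w -> x w = 1.
Proof. by move=> /orP[/eqP->|/eqP->]; rewrite ?test_vec_u ?test_vec_v. Qed.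

Lemma test_vec_interior w : w \in p1 ++ p2 ++ p3 ->
  exists s, [/\ uniq s, all (adj w) s, size s = 2%N,
    {subset s <= u :: v :: p1 ++ p2 ++ p3} & ideal_sum B x w s = lam * x w].
Proof.
move: ends => /and5P[Bc1 Bd1 Bc2 Bd2 /and3P[Bc3 Bd3 _]].
have inB z T : B z -> z \in u :: v :: T by rewrite !inE orbA => /= ->.
have sub p s c d : {subset p <= p1 ++ p2 ++ p3} -> B c -> B d ->
    {subset s <= c :: d :: p} -> {subset s <= u :: v :: p1 ++ p2 ++ p3}.
  move=> sp Bc Bd ss z /ss; rewrite 2!inE => /or3P[/eqP->|/eqP->|/sp zp].
  - exact: inB.
  - exact: inB.
  - by rewrite !inE zp !orbT.
have go c d p : is_arm c d p -> B c -> B d -> {subset p <= p1 ++ p2 ++ p3} ->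
    {in p, forall z, x z = arm_value p z} -> w \in p ->
    exists s, [/\ uniq s, all (adj w) s, size s = 2%N,
    {subset s <= u :: v :: p1 ++ p2 ++ p3} & ideal_sum B x w s = lam * x w].
  move=> ar Bc Bd sp xp wp.
  have [|||s [us ws sz ss es]] := arm_interior ar Bc Bd _ _ _ xp wp.
  - by move=> z /sp /pred2_notin.
  - exact: test_vec_B.
  - exact: test_vec_B.
  by exists s; split => //; apply: sub ss.
rewrite !mem_cat => /or3P[wp|wp|wp].
- by apply: (go _ _ _ arm1) => // [z|]; [rewrite !mem_cat => ->|exact: test_vec_p1].
- by apply: (go _ _ _ arm2) => // [z|]; [rewrite !mem_cat => ->;
  rewrite orbT|exact: test_vec_p2].
have p3n : p3 != [::] by apply: contraTneq wp => ->.
move: arm3; rewrite p3n /= => arm3'.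
by apply: (go _ _ _ arm3') => // [z|]; [rewrite !mem_cat => ->;
  rewrite !orbT|exact: test_vec_p3].
Qed.

Hypothesis branch_deg : forall w, B w -> (3 <= degree w)%N.

Lemma ideal_deg_le w : w \in u :: v :: p1 ++ p2 ++ p3 -> (ideal_deg B w <= degree w)%N.
Proof.
rewrite 2!inE orbA => /orP[Bw|wp].
  by rewrite /ideal_deg /= Bw; apply: branch_deg.
have [s [us ws sz _ _]] := test_vec_interior wp.
by rewrite /ideal_deg (negPf (pred2_notin wp)) -sz degree_ge.
Qed.

Lemma ideal_sum_le_fadj w s : w \in u :: v :: p1 ++ p2 ++ p3 ->
  uniq s -> all (adj w) s -> {subset s <= u :: v :: p1 ++ p2 ++ p3} ->
  ideal_sum B x w s <= fadj_apply f x w.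
Proof.
move=> wS us ws ss; apply: ideal_sum_le => //; first exact: test_vec_ge0.
by move=> z; rewrite inE => /orP[/eqP->|/ss]; apply: ideal_deg_le.
Qed.

(** Off the structure the factor [x w] vanishes; inside an arm the recurrence is exact for the ideal
    weights, and the actual ones are no smaller. Only the sum over [u] and [v] is assumed large, but
    the equality case gives an eigenvector and so determines each term. *)
Lemma test_vec_rayleigh :
  2 * lam <= fadj_apply f x u + fadj_apply f x v -> rho f G <= lam ->
  fadj_apply f x u = lam /\ fadj_apply f x v = lam.
Proof.
move=> le_uv rho_le; suff xE : forall w, fadj_apply f x w = lam * x w.
  by rewrite !xE test_vec_u test_vec_v mulr1.
move=> w0; apply: (rho_rayleigh f_sym rho_le).
have rest w : ~~ B w -> 0 <= (fadj_apply f x w - lam * x w) * x w.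
  move=> Bw; case: (boolP (w \in p1 ++ p2 ++ p3)) => wp; last first.
    by rewrite test_vec_out// !mulr0.
  rewrite mulr_ge0 ?test_vec_ge0// subr_ge0.
  have [s [us ws sz ss <-]] := test_vec_interior wp.
  by apply: ideal_sum_le_fadj; rewrite // 2!inE wp !orbT.
rewrite (bigID B) /= addr_ge0 //; last exact: sumr_ge0.
(* If [u = v], the hypothesis counts the only branch vertex twice. *)
case: (eqVneq u v) => [uv|uv].
  rewrite (eq_bigl (pred1 u)) => [|w]; last by rewrite /= -uv orbb.
  rewrite big_pred1_eq test_vec_u !mulr1 -(@pmulr_lge0 _ 2) ?ltr0n//.
  by move: le_uv; rewrite -uv; lra.
rewrite (bigD1 u) ?eqxx//= (bigD1 v) /= ?eqxx ?orbT 1?eq_sym//.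
rewrite big1 => [|w]; last by case: (w == u); case: (w == v).
by rewrite test_vec_u test_vec_v !mulr1; move: le_uv; lra.
Qed.

Hypothesis uv : u != v.
Hypothesis covers : forall w, w \in u :: v :: p1 ++ p2 ++ p3.
Hypothesis few_edges : (#|edges G| <= #|G|.+1)%N.

(** Squeezing: the ideal degrees sum to [2 * #|G|.+1], the actual ones are pointwise no smaller, and
    their sum is at most twice the number of edges. *)
Lemma exact_degree : (forall w, ideal_deg B w = degree w) /\ #|edges G| = #|G|.+1.
Proof.
have le_deg w : (ideal_deg B w <= degree w)%N by apply: ideal_deg_le.
have sum_ideal : (\sum_w ideal_deg B w = 2 * #|G|.+1)%N.
  have -> : (\sum_w ideal_deg B w = \sum_w (2 + B w))%N.
    by apply: eq_bigr => w _; rewrite /ideal_deg; case: (B w).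
  have cB : (\sum_w B w = 2)%N.
    transitivity #|pred2 u v|; last by rewrite card2 uv.
    by rewrite -sum1_card [RHS]big_mkcond; apply: eq_bigr => w _;
      rewrite -topredE /=; case: (_ || _).
  by rewrite big_split /= cB sum_nat_const [RHS]mulnS addnC [(2 * _)%N]mulnC.
have h2 := degree_sum_le G.
have h1 : (\sum_w ideal_deg B w <= \sum_(w : G) degree w)%N by apply: leq_sum.
rewrite sum_ideal in h1.
split; last by apply/eqP; rewrite eqn_leq few_edges /= -(@leq_pmul2l 2) // (leq_trans
  h1 h2).
have : (\sum_w ideal_deg B w <= \sum_(w : G) degree w ?= iff
        [forall (w | true), ideal_deg B w == degree w])%N.
  by apply: leqif_sum => w _; apply: leqif_eq.
case=> _ e w; apply/eqP; move: e; rewrite sum_ideal.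
have -> : (2 * #|G|.+1 == \sum_(w : G) degree w)%N.
  by rewrite eqn_leq h1 (leq_trans h2)// leq_pmul2l.
by move/esym/forallP/(_ w).
Qed.

Lemma structure_rho Nu Nv :
  uniq Nu -> all (adj u) Nu -> size Nu = 3%N -> ideal_sum B x u Nu = lam ->
  uniq Nv -> all (adj v) Nv -> size Nv = 3%N -> ideal_sum B x v Nv = lam ->
  rho f G = lam.
Proof.
move=> uNu aNu sNu eNu uNv aNv sNv eNv; have [deg _] := exact_degree.
have dE z (s : seq G) : {in z :: s, forall w, ideal_deg B w = degree w} by [].
apply: (rho_eqP f_gt0 f_sym (x := x) u) => w; first exact: test_vec_gt0.
have := covers w; rewrite 2!inE orbA => /orP[Bw|wp].
  rewrite (test_vec_B Bw) mulr1; case/orP: Bw => /eqP->.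
    by rewrite (ideal_sum_eq x uNu aNu _ (dE _ _))// sNu -deg /ideal_deg /= eqxx.
  by rewrite (ideal_sum_eq x uNv aNv _ (dE _ _))// sNv -deg /ideal_deg /= eqxx orbT.
have [s [us ws sz _ <-]] := test_vec_interior wp.
apply: ideal_sum_eq => //.
by rewrite sz -deg /ideal_deg (negPf (pred2_notin wp)).
Qed.

End Structure.

Lemma arm_weight_head (G : sgraph) (B : pred G) u v p x : is_arm u v p ->
  B u -> B v -> {in p, forall z, ~~ B z} -> x v = 1 ->
  {in p, forall z, x z = arm_value p z} ->
  [/\ adj u (head v p), head v p \in v :: p,
      arm_weight p <= ideal_sum B x u [:: head v p]
    & (0 < size p)%N -> ideal_sum B x u [:: head v p] = arm_weight p].
Proof.
case: p => [|z p] ar Bu Bv Bp xv xp.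
  case/and5P: ar => /= /andP[uv _] _ _ _ _; rewrite uv mem_head; split => //.
  exact: short_arm_end.
have [uz zp ->] := arm_head ar isT Bu Bp xp.
by split; rewrite // inE zp orbT.
Qed.

Lemma arm_weight_last (G : sgraph) (B : pred G) u v p x : is_arm u v p ->
  B u -> B v -> {in p, forall z, ~~ B z} -> x u = 1 ->
  {in p, forall z, x z = arm_value p z} ->
  [/\ adj v (last u p), last u p \in u :: p,
      arm_weight p <= ideal_sum B x v [:: last u p]
    & (0 < size p)%N -> ideal_sum B x v [:: last u p] = arm_weight p].
Proof.
move=> ar Bu Bv Bp xu xp; case: (eqVneq p [::]) ar Bp xp => [->|pn] ar Bp xp.
  case/and5P: ar => /= /andP[uv _] _ _ _ _.
  rewrite adj_sym uv mem_head; split => //; exact: short_arm_end.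
have [uz zp E] := arm_last ar pn Bv Bp xp.
have {}E : ideal_sum B x v [:: last u p] = arm_weight p by rewrite E /arm_weight;
  case: (p) pn.
by split; rewrite // ?inE ?zp ?orbT// E.
Qed.

Lemma head_neq_last (T : eqType) (d : T) (p : seq T) :
  uniq p -> (1 < size p)%N -> head d p != last d p.
Proof.
case: p => [|z [|z' p]] //= /andP[zp _] _.
by apply: contraNneq zp => ->; apply: mem_last.
Qed.

Lemma head_mem (T : eqType) (d : T) (p : seq T) : (0 < size p)%N -> head d p \in p.
Proof. by case: p => // z p _; rewrite mem_head. Qed.

Lemma last_mem (T : eqType) (d : T) (p : seq T) : (0 < size p)%N -> last d p \in p.
Proof. by case: p => // z p _; rewrite /= mem_last. Qed.

Lemma uniq_cat3 (T : eqType) (p1 p2 p3 : seq T) : uniq (p1 ++ p2 ++ p3) ->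
  [/\ uniq p1, uniq p2 & uniq p3] /\
  [/\ {in p1 & p2, forall y z, y != z}, {in p1 & p3, forall y z, y != z}
    & {in p2 & p3, forall y z, y != z}].
Proof.
rewrite !cat_uniq => /and5P[-> /hasPn h1 -> /hasPn h2 ->]; split => //.
split=> y z yp zp; apply/eqP => e.
- by have := h1 z; rewrite mem_cat zp /= -e yp => /(_ isT).
- by have := h1 z; rewrite mem_cat zp orbT /= -e yp => /(_ isT).
- by have := h2 z; rewrite zp /= -e yp => /(_ isT).
Qed.

Lemma notin_cat3 (T : eqType) (p1 p2 p3 : seq T) z : z \notin p1 ++ p2 ++ p3 ->
  [/\ z \notin p1, z \notin p2 & z \notin p3].
Proof. by rewrite !mem_cat !negb_or => /and3P[]. Qed.

Lemma mem_neq (T : eqType) (p : seq T) y z : y \in p -> z \notin p -> y != z.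
Proof. by move=> yp; apply: contraNneq => <-. Qed.

(** [N] holds one neighbour for each arm end at [w]. Equality is claimed only if the third arm has
    inner vertices, since an edge contributes [f 3 3] instead of [b]. *)
Definition branch_data (G : sgraph) (u v : G) p1 p2 p3 w (W : R) (N : seq G) : Prop :=
  [/\ uniq N, all (adj w) N, size N = 3%N
    & {subset N <= u :: v :: p1 ++ p2 ++ p3}] /\
  (W <= ideal_sum (pred2 u v) (test_vec u v p1 p2 p3) w N /\
   ((0 < size p3)%N -> ideal_sum (pred2 u v) (test_vec u v p1 p2 p3) w N = W)).

Lemma theta_structure (G : sgraph) (u v : G) p1 p2 p3 :
  theta_in u v p1 p2 p3 ->
  [/\ u != v, uniq (p1 ++ p2 ++ p3), u \notin p1 ++ p2 ++ p3
    & v \notin p1 ++ p2 ++ p3] /\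
  [/\ is_arm u v p1, is_arm u v p2, is_arm u v p3,
    exists N, branch_data u v p1 p2 p3 u
      (arm_weight p1 + arm_weight p2 + arm_weight p3) N
  & exists N, branch_data u v p1 p2 p3 v
      (arm_weight p1 + arm_weight p2 + arm_weight p3) N].
Proof.
move=> [U P1 P2 P3 /andP[S1 S2]].
move: U; rewrite cons_uniq inE negb_or => /andP[/andP[uv up]].
rewrite cons_uniq => /andP[vp U]; split => //.
have [up1 up2 up3] := notin_cat3 up; have [vp1 vp2 vp3] := notin_cat3 vp.
have [[u1 u2 u3] [n12 n13 n23]] := uniq_cat3 U.
have A1 : is_arm u v p1 by apply/and5P; split; rewrite ?uv.
have A2 : is_arm u v p2 by apply/and5P; split; rewrite ?uv.
have A3 : is_arm u v p3 by apply/and5P; split; rewrite ?uv.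
pose B : pred G := pred2 u v; pose x := test_vec u v p1 p2 p3.
have Bu : B u by rewrite /B /= eqxx.
have Bv : B v by rewrite /B /= eqxx orbT.
have Bp := pred2_notin up vp.
have Bp1 z : z \in p1 -> ~~ B z by move=> zp; rewrite Bp// mem_cat zp.
have Bp2 z : z \in p2 -> ~~ B z by move=> zp; rewrite Bp// !mem_cat zp orbT.
have Bp3 z : z \in p3 -> ~~ B z by move=> zp; rewrite Bp// !mem_cat zp !orbT.
have xu : x u = 1 := test_vec_u _ _ _ _ _; have xv : x v = 1 := test_vec_v _ _ _ _ _.
have x1 := test_vec_p1 up vp; have x2 := test_vec_p2 U up vp; have x3 :=
  test_vec_p3 U up vp.
have hp1 := head_mem v S1; have hp2 := head_mem v S2.
have lp1 := last_mem u S1; have lp2 := last_mem u S2.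
split=> //.
- have [a1 _ w1 e1] := arm_weight_head A1 Bu Bv Bp1 xv x1.
  have [a2 _ w2 e2] := arm_weight_head A2 Bu Bv Bp2 xv x2.
  have [a3 m3 w3 e3] := arm_weight_head A3 Bu Bv Bp3 xv x3.
  exists ([:: head v p1] ++ [:: head v p2] ++ [:: head v p3]).
  split; last first.
    rewrite !ideal_sum_cat e1// e2// addrA lerD2l; split=> // S3.
    by rewrite e3.
  split => //.
  + rewrite /= !inE !negb_or n12//= andbT; move: m3; rewrite inE => /orP[/eqP->|m3].
      by rewrite (mem_neq hp1 vp1) (mem_neq hp2 vp2).
    by rewrite n13// n23.
  + by rewrite /= a1 a2 a3.
  + move=> z; rewrite !inE !mem_cat => /or3P[] /eqP->; rewrite ?hp1 ?hp2 ?orbT//.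
    by move: m3; rewrite inE => /orP[->|->]; rewrite ?orbT.
- have [a1 _ w1 e1] := arm_weight_last A1 Bu Bv Bp1 xu x1.
  have [a2 _ w2 e2] := arm_weight_last A2 Bu Bv Bp2 xu x2.
  have [a3 m3 w3 e3] := arm_weight_last A3 Bu Bv Bp3 xu x3.
  exists ([:: last u p1] ++ [:: last u p2] ++ [:: last u p3]).
  split; last first.
    rewrite !ideal_sum_cat e1// e2// addrA lerD2l; split=> // S3.
    by rewrite e3.
  split => //.
  + rewrite /= !inE !negb_or n12//= andbT; move: m3; rewrite inE => /orP[/eqP->|m3].
      by rewrite (mem_neq lp1 up1) (mem_neq lp2 up2).
    by rewrite n13// n23.
  + by rewrite /= a1 a2 a3.
  + move=> z; rewrite !inE !mem_cat => /or3P[] /eqP->; rewrite ?lp1 ?lp2 ?orbT//.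
    by move: m3; rewrite inE => /orP[->|->]; rewrite ?orbT.
Qed.

(** A cycle meets its branch vertex at both ends, hence the doubled weight; the average of the two
    branch sums is the sum that occurs for a theta. *)
Lemma infinity_structure (G : sgraph) (u v : G) p1 p2 p3 :
  infinity_in u v p1 p2 p3 ->
  [/\ u != v, uniq (p1 ++ p2 ++ p3), u \notin p1 ++ p2 ++ p3
    & v \notin p1 ++ p2 ++ p3] /\
  [/\ is_arm u u p1, is_arm v v p2, is_arm u v p3,
    exists N, branch_data u v p1 p2 p3 u
      (arm_weight p1 + arm_weight p1 + arm_weight p3) N
  & exists N, branch_data u v p1 p2 p3 v
      (arm_weight p2 + arm_weight p2 + arm_weight p3) N].
Proof.
move=> [U P1 P2 P3 /andP[S1 S2]].
move: U; rewrite cons_uniq inE negb_or => /andP[/andP[uv up]].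
rewrite cons_uniq => /andP[vp U]; split => //.
have [up1 up2 up3] := notin_cat3 up; have [vp1 vp2 vp3] := notin_cat3 vp.
have [[u1 u2 u3] [n12 n13 n23]] := uniq_cat3 U.
have A1 : is_arm u u p1 by apply/and5P; split; rewrite ?S1 ?orbT.
have A2 : is_arm v v p2 by apply/and5P; split; rewrite ?S2 ?orbT.
have A3 : is_arm u v p3 by apply/and5P; split; rewrite ?uv.
pose B : pred G := pred2 u v; pose x := test_vec u v p1 p2 p3.
have Bu : B u by rewrite /B /= eqxx.
have Bv : B v by rewrite /B /= eqxx orbT.
have Bp := pred2_notin up vp.
have Bp1 z : z \in p1 -> ~~ B z by move=> zp; rewrite Bp// mem_cat zp.
have Bp2 z : z \in p2 -> ~~ B z by move=> zp; rewrite Bp// !mem_cat zp orbT.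
have Bp3 z : z \in p3 -> ~~ B z by move=> zp; rewrite Bp// !mem_cat zp !orbT.
have xu : x u = 1 := test_vec_u _ _ _ _ _; have xv : x v = 1 := test_vec_v _ _ _ _ _.
have x1 := test_vec_p1 up vp; have x2 := test_vec_p2 U up vp; have x3 :=
  test_vec_p3 U up vp.
have hp1 := head_mem u (ltnW S1); have hp2 := head_mem v (ltnW S2).
have lp1 := last_mem u (ltnW S1); have lp2 := last_mem v (ltnW S2).
split=> //.
- have [a1 _ w1 e1] := arm_weight_head A1 Bu Bu Bp1 xu x1.
  have [a2 _ w2 e2] := arm_weight_last A1 Bu Bu Bp1 xu x1.
  have [a3 m3 w3 e3] := arm_weight_head A3 Bu Bv Bp3 xv x3.
  exists ([:: head u p1] ++ [:: last u p1] ++ [:: head v p3]).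
  split; last first.
    rewrite !ideal_sum_cat e1 ?(ltnW S1)// e2 ?(ltnW S1)// addrA lerD2l; split=> // S3.
    by rewrite e3.
  split => //.
  + rewrite /= !inE !negb_or head_neq_last//= andbT.
    move: m3; rewrite inE => /orP[/eqP->|m3].
      by rewrite (mem_neq hp1 vp1) (mem_neq lp1 vp1).
    by rewrite !n13.
  + by rewrite /= a1 a2 a3.
  + move=> z; rewrite !inE !mem_cat => /or3P[] /eqP->; rewrite ?hp1 ?lp1 ?orbT//.
    by move: m3; rewrite inE => /orP[->|->]; rewrite ?orbT.
- have [a1 _ w1 e1] := arm_weight_head A2 Bv Bv Bp2 xv x2.
  have [a2 _ w2 e2] := arm_weight_last A2 Bv Bv Bp2 xv x2.
  have [a3 m3 w3 e3] := arm_weight_last A3 Bu Bv Bp3 xu x3.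
  exists ([:: head v p2] ++ [:: last v p2] ++ [:: last u p3]).
  split; last first.
    rewrite !ideal_sum_cat e1 ?(ltnW S2)// e2 ?(ltnW S2)// addrA lerD2l; split=> // S3.
    by rewrite e3.
  split => //.
  + rewrite /= !inE !negb_or head_neq_last//= andbT.
    move: m3; rewrite inE => /orP[/eqP->|m3].
      by rewrite (mem_neq hp2 up2) (mem_neq lp2 up2).
    by rewrite !n23.
  + by rewrite /= a1 a2 a3.
  + move=> z; rewrite !inE !mem_cat => /or3P[] /eqP->; rewrite ?hp2 ?lp2 ?orbT//.
    by move: m3; rewrite inE => /orP[->|->]; rewrite ?orbT.
Qed.

(** * Comparison of the three structures with [lam] *)

Section Bounds.
Variables s t : nat.
Hypotheses (st : (s <= t.+1)%N) (ts : (t <= s.+1)%N) (n8 : (8 < 2 * s + t)%N).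
Hypothesis decay_eq :
  a ^+ 2 * (1 + q ^+ 2) = b ^+ 2 * (q * (2 * arm_end q s + arm_end q t)).

Lemma lamE : lam = b ^+ 2 / a * (2 * arm_end q s + arm_end q t).
Proof.
have a0 := a_gt0; have aq : a * q != 0 by rewrite mulf_neq0 ?lt0r_neq0.
apply: (mulfI aq); rewrite /lam; have := decay_eq; set S := 2 * _ + _ => d.
transitivity (a ^+ 2 * (1 + q ^+ 2)); first by field; rewrite !lt0r_neq0.
by rewrite d; field; rewrite !lt0r_neq0.
Qed.

Let K := b ^+ 2 / a.
Lemma K_gt0 : 0 < K.
Proof. by rewrite divr_gt0 ?exprn_gt0 ?a_gt0 ?b_gt0. Qed.

Lemma arm_weightE (G : sgraph) (p : seq G) :
  (0 < size p)%N -> arm_weight p = K * arm_end q (size p).+1.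
Proof. by case: p. Qed.

Definition balanced (l1 l2 l3 : nat) : Prop :=
  [\/ [/\ l1 = s, l2 = s & l3 = t], [/\ l1 = s, l2 = t & l3 = s]
     | [/\ l1 = t, l2 = s & l3 = s]].

Lemma arm_weight_sum (G : sgraph) (p1 p2 p3 : seq G) :
  (0 < size p1)%N -> (0 < size p2)%N ->
  ((size p1).+1 + (size p2).+1 + (size p3).+1 <= 2 * s + t)%N ->
  lam <= arm_weight p1 + arm_weight p2 + arm_weight p3 /\
  (arm_weight p1 + arm_weight p2 + arm_weight p3 = lam ->
   balanced (size p1).+1 (size p2).+1 (size p3).+1).
Proof.
have wE := @arm_weightE G.
move=> p1n p2n le_l; rewrite lamE -/K (wE p1)// (wE p2)// -(mulrDr K); have K0 := K_gt0.
(* If the third arm is an edge, the inequality is strict, so the equality clause is vacuous. *)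
case: p3 le_l => [|z p3] le_l.
  have lt_l : ((size p1).+1 + (size p2).+1 < 2 * s + t)%N by rewrite -addn1.
  have := short_arm q_gt0 q_lt1 a_gt0 le_ab decay_eq st ts n8 lt_l.
  rewrite -/K [b + _]addrC => h; split; first exact: ltW.
  by move=> e; move: h; rewrite e ltxx.
rewrite wE// -(mulrDr K) ler_pM2l//.
have [h1 h2] := sum3_balanced (arm_end_convex q_gt0 q_lt1) (arm_end_decr q_gt0 q_lt1)
  st ts le_l.
by split => // /(mulfI (lt0r_neq0 K0)) /h2.
Qed.

Lemma structure_size (G : sgraph) (u v : G) p1 p2 p3 :
  uniq (u :: v :: p1 ++ p2 ++ p3) -> (#|G| < 2 * s + t)%N ->
  ((size p1).+1 + (size p2).+1 + (size p3).+1 <= 2 * s + t)%N.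
Proof.
move=> U cG; apply: leq_trans cG; have := max_card (mem (u :: v :: p1 ++ p2 ++ p3)).
by rewrite (card_uniqP U) /= !size_cat; clear; lia.
Qed.

Lemma branch_degree (G : sgraph) (u v : G) p1 p2 p3 W1 W2 N1 N2 :
  branch_data u v p1 p2 p3 u W1 N1 -> branch_data u v p1 p2 p3 v W2 N2 ->
  forall w, pred2 u v w -> (3 <= degree w)%N.
Proof.
move=> [[u1 a1 s1 _] _] [[u2 a2 s2 _] _] w /orP[/eqP->|/eqP->].
  by rewrite -s1; apply: degree_ge.
by rewrite -s2; apply: degree_ge.
Qed.

Lemma theta_bound (G : sgraph) (u v : G) p1 p2 p3 :
  theta_in u v p1 p2 p3 -> (#|G| < 2 * s + t)%N -> rho f G <= lam ->
  balanced (size p1).+1 (size p2).+1 (size p3).+1.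
Proof.
move=> th cG rho_le; have [U0 P1 P2 P3 /andP[S1 S2]] := th.
have [ge_lam bal] := arm_weight_sum S1 S2 (structure_size U0 cG).
have [[uv U up vp] [A1 A2 A3 [N1 D1] [N2 D2]]] := theta_structure th.
have bd := branch_degree D1 D2; move: D1 D2 => [[uN1 aN1 _ sN1] [w1 _]] [[uN2 aN2 _
  sN2] [w2 _]].
have A3' : (p3 != [::]) ==> is_arm u v p3 by rewrite A3 implybT.
have en : all (pred2 u v) [:: u; v; u; v; u; v] by rewrite /= !eqxx !orbT.
have Au := ideal_sum_le_fadj U up vp A1 A2 A3' en bd (mem_head _ _) uN1 aN1 sN1.
have vS : v \in u :: v :: p1 ++ p2 ++ p3 by rewrite !inE eqxx orbT.
have Av := ideal_sum_le_fadj U up vp A1 A2 A3' en bd vS uN2 aN2 sN2.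
have [|Eu _] := test_vec_rayleigh U up vp A1 A2 A3' en bd _ rho_le.
  by lra.
by apply: bal; apply/le_anti; rewrite ge_lam andbT -Eu (le_trans w1 Au).
Qed.

Lemma infinity_bound (G : sgraph) (u v : G) p1 p2 p3 :
  infinity_in u v p1 p2 p3 -> (#|G| < 2 * s + t)%N -> rho f G <= lam ->
  [/\ (size p1).+1 = s, (size p2).+1 = s & (size p3).+1 = t].
Proof.
move=> inf cG rho_le; have [U0 P1 P2 P3 /andP[S1 S2]] := inf.
have [ge_lam bal] := arm_weight_sum (ltnW S1) (ltnW S2) (structure_size U0 cG).
have [[uv U up vp] [A1 A2 A3 [N1 D1] [N2 D2]]] := infinity_structure inf.
have bd := branch_degree D1 D2; move: D1 D2 => [[uN1 aN1 _ sN1] [w1 _]] [[uN2 aN2 _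
  sN2] [w2 _]].
have A3' : (p3 != [::]) ==> is_arm u v p3 by rewrite A3 implybT.
have en : all (pred2 u v) [:: u; u; v; v; u; v] by rewrite /= !eqxx !orbT.
have Au := ideal_sum_le_fadj U up vp A1 A2 A3' en bd (mem_head _ _) uN1 aN1 sN1.
have vS : v \in u :: v :: p1 ++ p2 ++ p3 by rewrite !inE eqxx orbT.
have Av := ideal_sum_le_fadj U up vp A1 A2 A3' en bd vS uN2 aN2 sN2.
have [|Eu Ev] := test_vec_rayleigh U up vp A1 A2 A3' en bd _ rho_le.
  by lra.
have {}w1 : arm_weight p1 + arm_weight p1 + arm_weight p3 <= lam by rewrite -Eu
  (le_trans w1 Au).
have {}w2 : arm_weight p2 + arm_weight p2 + arm_weight p3 <= lam by rewrite -Ev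
  (le_trans w2 Av).
(* [w1] and [w2] add up to the reverse of [ge_lam], doubled, so both are equalities. *)
have E : arm_weight p1 = arm_weight p2 by lra.
have sz : size p1 = size p2.
  move: E; rewrite /arm_weight; case: (p1) S1 => // z1 r1 _; case: (p2) S2 => // z2 r2 _.
  move/(mulfI (lt0r_neq0 K_gt0))/(decr_inj (arm_end_decr q_gt0 q_lt1)).
  by case=> e; rewrite /= e.
have : balanced (size p1).+1 (size p2).+1 (size p3).+1.
  by apply: bal; apply/le_anti; rewrite ge_lam andbT; lra.
(* With equal cycles, the other two positions of [t] force [s = t]. *)
by rewrite sz => -[] [e1 e2 e3]; split; congruence.
Qed.

(** Counting the centre as if of degree 3 suffices: its four cycle ends exceed [4 * (K * q) >= lam]
    strictly, while the equality case of the Rayleigh bound would give exactly [lam]. *)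
Lemma eight_bound (G : sgraph) (u : G) p1 p2 :
  eight_in u p1 p2 -> (3 <= s)%N -> (3 <= t)%N -> ~ rho f G <= lam.
Proof.
move=> [U0 P1 P2 /andP[S1 S2]] s3 t3 rho_le.
move: U0; rewrite cons_uniq => /andP[up' U'].
have U : uniq (p1 ++ p2 ++ [::]) by rewrite cats0.
have up : u \notin p1 ++ p2 ++ [::] by rewrite cats0.
have [up1 up2 _] := notin_cat3 up.
have [[u1 u2 _] [n12 _ _]] := uniq_cat3 U.
have A1 : is_arm u u p1 by apply/and5P; split; rewrite ?S1 ?orbT.
have A2 : is_arm u u p2 by apply/and5P; split; rewrite ?S2 ?orbT.
pose B : pred G := pred2 u u; pose x := test_vec u u p1 p2 [::].
have Bu : B u by rewrite /B /= eqxx.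
have Bp := pred2_notin up up.
have Bp1 z : z \in p1 -> ~~ B z by move=> zp; rewrite Bp// mem_cat zp.
have Bp2 z : z \in p2 -> ~~ B z by move=> zp; rewrite Bp// !mem_cat zp orbT.
have xu : x u = 1 := test_vec_u _ _ _ _ _.
have x1 := test_vec_p1 up up; have x2 := test_vec_p2 U up up.
have hp1 := head_mem u (ltnW S1); have hp2 := head_mem u (ltnW S2).
have lp1 := last_mem u (ltnW S1); have lp2 := last_mem u (ltnW S2).
have [a1 _ _ e1] := arm_weight_head A1 Bu Bu Bp1 xu x1.
have [a2 _ _ e2] := arm_weight_last A1 Bu Bu Bp1 xu x1.
have [a3 _ _ e3] := arm_weight_head A2 Bu Bu Bp2 xu x2.
have [a4 _ _ e4] := arm_weight_last A2 Bu Bu Bp2 xu x2.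
pose N := [:: head u p1] ++ [:: last u p1] ++ [:: head u p2] ++ [:: last u p2].
have uN : uniq N by rewrite /= !inE !negb_or !head_neq_last// !n12.
have aN : all (adj u) N by rewrite /= a1 a2 a3 a4.
have sN : {subset N <= u :: u :: p1 ++ p2 ++ [::]}.
  by move=> z; rewrite !inE !mem_cat => /or4P[] /eqP->; rewrite ?hp1 ?hp2 ?lp1 ?lp2 ?orbT.
have bd w : B w -> (3 <= degree w)%N.
  by case/orP => /eqP->; apply: ltnW; apply: (degree_ge uN aN).
have A3' : ([::] != [::] :> seq G) ==> is_arm u u [::] by [].
have en : all B [:: u; u; u; u; u; u] by rewrite /= Bu.
have := ideal_sum_le_fadj U up up A1 A2 A3' en bd (mem_head _ _) uN aN sN.
rewrite /N !ideal_sum_cat e1 ?(ltnW S1)// e2 ?(ltnW S1)// e3 ?(ltnW S2)// e4 ?(ltnW S2)//.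
have wE (p : seq G) : (1 < size p)%N -> K * q < arm_weight p.
  by case: p => // z p _; rewrite ltr_pM2l ?K_gt0// arm_end_gt.
move=> Au; have lt1 := wE _ S1; have lt2 := wE _ S2.
have lam_le : lam <= 4 * (K * q).
  rewrite lamE -/K [leRHS]mulrCA ler_pM2l ?K_gt0//.
  have := three_arm_end3_le q_gt0 q_lt1; have decr := decr_le (arm_end_decr q_gt0 q_lt1).
  by have := decr _ _ s3; have := decr _ _ t3; lra.
have [|Eu _] := test_vec_rayleigh U up up A1 A2 A3' en bd _ rho_le.
  by lra.
by lra.
Qed.

Lemma structure_covers (G : sgraph) (u v : G) p1 p2 p3 :
  uniq (u :: v :: p1 ++ p2 ++ p3) ->
  (size p1).+1 = s -> (size p2).+1 = s -> (size p3).+1 = t ->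
  #|G|.+1 = (2 * s + t)%N -> forall w, w \in u :: v :: p1 ++ p2 ++ p3.
Proof.
move=> U s1 s2 s3 cG w; suff cS : #|u :: v :: p1 ++ p2 ++ p3| = #|G|.
  by have /(subset_cardP cS) -> := subset_predT (mem (u :: v :: p1 ++ p2 ++ p3)).
rewrite (card_uniqP U); apply: succn_inj; rewrite cG /= !size_cat.
by move: s1 s2 s3; clear; lia.
Qed.

Lemma theta_rho (G : sgraph) (u v : G) p1 p2 p3 :
  theta_in u v p1 p2 p3 ->
  (size p1).+1 = s -> (size p2).+1 = s -> (size p3).+1 = t -> (1 < t)%N ->
  #|G|.+1 = (2 * s + t)%N -> (#|edges G| <= #|G|.+1)%N ->
  rho f G = lam /\ #|edges G| = #|G|.+1.
Proof.
move=> th s1 s2 s3 t2 cG few; have [U0 _ _ _ /andP[S1 S2]] := th.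
have cov := structure_covers U0 s1 s2 s3 cG.
have S3 : (0 < size p3)%N by rewrite -ltnS s3.
have [[uv U up vp] [A1 A2 A3 [N1 D1] [N2 D2]]] := theta_structure th.
have bd := branch_degree D1 D2; move: D1 D2 => [[uN1 aN1 c1 _] [_ /(_ S3) e1]] [[uN2
  aN2 c2 _] [_ /(_ S3) e2]].
have A3' : (p3 != [::]) ==> is_arm u v p3 by rewrite A3 implybT.
have en : all (pred2 u v) [:: u; v; u; v; u; v] by rewrite /= !eqxx !orbT.
have W : arm_weight p1 + arm_weight p2 + arm_weight p3 = lam.
  rewrite lamE !arm_weightE// s1 s2 s3 -/K; ring.
split; last by have [_ ->] := exact_degree U up vp A1 A2 A3' en bd uv cov few.
apply: (structure_rho U up vp A1 A2 A3' en bd uv cov few uN1 aN1 c1 _ uN2 aN2 c2).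
  by rewrite e1.
by rewrite e2.
Qed.

Lemma infinity_rho (G : sgraph) (u v : G) p1 p2 p3 :
  infinity_in u v p1 p2 p3 ->
  (size p1).+1 = s -> (size p2).+1 = s -> (size p3).+1 = t -> (1 < t)%N ->
  #|G|.+1 = (2 * s + t)%N -> (#|edges G| <= #|G|.+1)%N ->
  rho f G = lam /\ #|edges G| = #|G|.+1.
Proof.
move=> inf s1 s2 s3 t2 cG few; have [U0 _ _ _ /andP[S1 S2]] := inf.
have cov := structure_covers U0 s1 s2 s3 cG.
have S3 : (0 < size p3)%N by rewrite -ltnS s3.
have [[uv U up vp] [A1 A2 A3 [N1 D1] [N2 D2]]] := infinity_structure inf.
have bd := branch_degree D1 D2; move: D1 D2 => [[uN1 aN1 c1 _] [_ /(_ S3) e1]] [[uN2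
  aN2 c2 _] [_ /(_ S3) e2]].
have A3' : (p3 != [::]) ==> is_arm u v p3 by rewrite A3 implybT.
have en : all (pred2 u v) [:: u; u; v; v; u; v] by rewrite /= !eqxx !orbT.
have W1 : arm_weight p1 + arm_weight p1 + arm_weight p3 = lam.
  by rewrite lamE !arm_weightE ?(ltnW S1)// s1 s3 -/K; ring.
have W2 : arm_weight p2 + arm_weight p2 + arm_weight p3 = lam.
  by rewrite lamE !arm_weightE ?(ltnW S2)// s2 s3 -/K; ring.
split; last by have [_ ->] := exact_degree U up vp A1 A2 A3' en bd uv cov few.
apply: (structure_rho U up vp A1 A2 A3' en bd uv cov few uN1 aN1 c1 _ uN2 aN2 c2).
  by rewrite e1.
by rewrite e2.
Qed.

Definition balanced_theta_in (G : sgraph) : Prop := exists u v p1 p2 p3,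
  @theta_in G u v p1 p2 p3 /\
  [/\ (size p1).+1 = s, (size p2).+1 = s & (size p3).+1 = t].

Definition balanced_infinity_in (G : sgraph) : Prop := exists u v p1 p2 p3,
  @infinity_in G u v p1 p2 p3 /\
  [/\ (size p1).+1 = s, (size p2).+1 = s & (size p3).+1 = t].

Lemma bicyclic_bound (G : sgraph) n : bicyclic n G -> n.+1 = (2 * s + t)%N ->
  (3 <= s)%N -> (3 <= t)%N -> rho f G <= lam ->
  balanced_theta_in G \/ balanced_infinity_in G.
Proof.
move=> [cG Gc eG] n_def s3 t3 rho_le.
have ltG : (#|G| < 2 * s + t)%N by rewrite cG -n_def.
have G0 : (0 < #|G|)%N by rewrite cG; move: n_def n8; clear; lia.
have [|[u [v [p1 [p2 [p3 th]]]]]|[u [v [p1 [p2 [p3 inf]]]]]|[u [p1 [p2 ei]]]] :=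
  exists_bicyclic_subgraph Gc G0; first by rewrite cG eG.
- left; have [_ _ _ _ /andP[S1 S2]] := th.
  have [[e1 e2 e3]|[e1 e2 e3]|[e1 e2 e3]] := theta_bound th ltG rho_le.
  + by exists u, v, p1, p2, p3.
  (* The arms of a theta are interchangeable, so the one of length [t] is moved to the third place;
     [3 <= s] ensures that the displaced arm is not an edge. *)
  + have S3 : (0 < size p3)%N by rewrite -ltnS e3 (leq_trans _ s3).
    by exists u, v, p1, p3, p2; split => //; apply: theta_inC23.
  + have S3 : (0 < size p3)%N by rewrite -ltnS e3 (leq_trans _ s3).
    exists u, v, p2, p3, p1; split => //; apply: theta_inC23 => //.
    exact: theta_inC12.
- by right; exists u, v, p1, p2, p3; split => //; exact: (infinity_bound inf ltG rho_le).
by case: (eight_bound ei s3 t3 rho_le).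
Qed.

End Bounds.

End TestVector.

(** * Extremality and uniqueness *)

Theorem theorem5p6 (R : realType) (f : R -> R -> R)
  (f_gt0 : forall x y : R, 0 < x -> 0 < y -> 0 < f x y)
  (f_sym : forall x y : R, 0 < x -> 0 < y -> f x y = f y x)
  (f_incr : forall x1 x2 y : R,
     0 < x1 -> x1 <= x2 -> 0 < y -> f x1 y <= f x2 y)
  (n s t : nat) (s_gt0 : (0 < s)%N) (t_gt0 : (0 < t)%N)
  (n_def : (2 * s + t - 1)%N = n) (n_ge8 : (8 <= n)%N)
  (st_near : `|s%:Z - t%:Z| <= 1) :
  [/\ minimizes_rho f n (theta_graph s s t),
      minimizes_rho f n (infinity_graph s s t)
    & forall G : sgraph, minimizes_rho f n G ->
        graph_iso G (theta_graph s s t) \/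
        graph_iso G (infinity_graph s s t)].
Proof.
have [st ts] : (s <= t.+1)%N /\ (t <= s.+1)%N by move: st_near; clear; lia.
have [s3 t3] : (3 <= s)%N /\ (3 <= t)%N by move: st ts n_def n_ge8; clear; lia.
have nS : n.+1 = (2 * s + t)%N by move: t_gt0 n_def; clear; lia.
have n8 : (8 < 2 * s + t)%N by rewrite -nS.
have nE : (s + s + t - 1)%N = n by rewrite -n_def mul2n addnn.
have nE1 : (s + s + t)%N = n.+1 by rewrite nS mul2n addnn.
have [q /andP[q0 q1] decay] :=
  exists_decay (a_gt0 f_gt0) (le_ab f_sym f_incr) s_gt0 t_gt0.
pose lam := f 2 2 * (q + q^-1).
(* Only an upper bound on the edges is assumed, as this is all that is known so far for the concrete
   graphs; their exact count is part of the conclusion. *)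
have theta_lam (G : sgraph) : #|G| = n -> (#|edges G| <= n.+1)%N -> balanced_theta_in
  s t G ->
    rho f G = lam /\ #|edges G| = n.+1.
  move=> cG eG [u [v [p1 [p2 [p3 [th [s1 s2 s3']]]]]]]; rewrite -cG in eG nS *.
  exact: (theta_rho f_gt0 f_sym f_incr q0 q1 decay th s1 s2 s3' (ltnW t3)).
have infinity_lam (G : sgraph) : #|G| = n -> (#|edges G| <= n.+1)%N ->
  balanced_infinity_in s t G ->
    rho f G = lam /\ #|edges G| = n.+1.
  move=> cG eG [u [v [p1 [p2 [p3 [inf [s1 s2 s3']]]]]]]; rewrite -cG in eG nS *.
  exact: (infinity_rho f_gt0 f_sym f_incr q0 q1 decay inf s1 s2 s3' (ltnW t3)).
have base G : bicyclic n G -> rho f G <= lam ->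
    balanced_theta_in s t G \/ balanced_infinity_in s t G.
  move=> bG; exact: (bicyclic_bound f_gt0 f_sym f_incr q0 q1 st ts n8 decay bG nS s3 t3).
(* The lower bound follows from the equality case: a spectral radius below [lam] would force a
   balanced structure, whose spectral radius is [lam]. *)
have lam_le H : bicyclic n H -> lam <= rho f H.
  move=> bH; rewrite leNgt; apply/negP => lt_lam; have [cH _ eH] := bH.
  have eq_lam : rho f H = lam.
    by have [/theta_lam[]|/infinity_lam[]] := base _ bH (ltW lt_lam); rewrite ?eH.
  by rewrite eq_lam ltxx in lt_lam.
have [u [v [p1 [p2 [p3 [th sz]]]]]] := theta_graph_structure (ltnW s3) (ltnW s3) t_gt0.
have [u' [v' [p1' [p2' [p3' [inf sz']]]]]] := infinity_graph_structure s3 s3 t_gt0.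
have cT : #|theta_graph s s t| = n by rewrite card_ord.
have cI : #|infinity_graph s s t| = n by rewrite card_ord.
have [rT eT] : rho f (theta_graph s s t) = lam /\ #|edges (theta_graph s s t)| = n.+1.
  apply: theta_lam => //; last by exists u, v, p1, p2, p3.
  by rewrite -nE1 card_edges_theta_graph.
have [rI eI] : rho f (infinity_graph s s t) = lam /\ #|edges (infinity_graph s s t)|
  = n.+1.
  apply: infinity_lam => //; last by exists u', v', p1', p2', p3'.
  by rewrite -nE1 card_edges_infinity_graph.
have bT : bicyclic n (theta_graph s s t).
  split => //; apply: (theta_connected th).
  by case: th sz => U _ _ _ _ [s1 s2 s3']; apply: (structure_covers U s1 s2 s3');
    rewrite cT.
have bI : bicyclic n (infinity_graph s s t).
  split => //; apply: (infinity_connected inf).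
  by case: inf sz' => U _ _ _ _ [s1 s2 s3']; apply: (structure_covers U s1 s2 s3');
    rewrite cI.
split; [by split => // H /lam_le; rewrite rT|by split => // H /lam_le; rewrite rI|].
move=> G [bG /(_ _ bT)]; rewrite rT => rG; have [cG _ eG] := bG.
case: (base G bG rG) => -[x [y [r1 [r2 [r3 [str [s1 s2 s3']]]]]]].
  by left; apply: (theta_iso s1 s2 s3' _ str); rewrite ?cG ?eG.
by right; apply: (infinity_iso s1 s2 s3' _ str); rewrite ?cG ?eG.
Qed.
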